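(* Let $p\in(0,1)$, let $D_1$ be the geometric distribution on $\{1,2,\dots\}$ with $D_1(y)=(1-p)p^{y-1}$, and let $\mathrm{Cap}(D_1)$ be the capacity (in nats per channel use) of the geometric sticky channel, i.e. the binary repeat channel with replication distribution $D_1$. For integers $y\ge1$ put $$\Lambda_1(y)=\int_0^1\frac{1+t-ty(1-p)-\left(\frac{1-t}{1-pt}\right)^y/(1-t)}{t\log(1-t)}\,dt,\qquad \Lambda_2(y)=\int_0^1\frac{1-typ-\left(\frac{1}{1+pt}\right)^y}{t\log(1-t)}\,dt,$$ and for $q\in(0,1)$ let $y_0=y_0(q)$ be defined by $$\frac1{y_0}=\sum_{y=1}^\infty q^y e^{\log (y-1)!-\Lambda_1(y)-\Lambda_2(y)-yh(p)}<\infty ,$$ and $$\mathbb{E}[Y^{(q)}]=\sum_{y=1}^\infty y_0\,y\,q^y e^{\log (y-1)!-\Lambda_1(y)-\Lambda_2(y)-yh(p)}.$$ Then $$\mathrm{Cap}(D_1)\le\sup_{\mu\ge 1/(1-p)}\frac{\inf_{q\in(0,1)}(-\log y_0-\mu\log q)}{\mu(1-p)}\le\sup_{q\in(0,1):\ \mathbb{E}[Y^{(q)}]\ge 1/(1-p)}\frac{-\log y_0-\mathbb{E}[Y^{(q)}]\log q}{\mathbb{E}[Y^{(q)}](1-p)}.$$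
   Context: $\log$ is the natural logarithm and $h(p)=-p\log p-(1-p)\log(1-p)$; all information quantities are in nats. For a random variable $D$ supported on the non-negative integers, the repeat channel with replication distribution $D$ takes a bit string $x_1\cdots x_n\in\{0,1\}^n$ and outputs the string obtained by replacing each $x_i$ by $D_i$ consecutive copies of $x_i$, where $D_1,D_2,\dots$ are i.i.d. copies of $D$; the receiver sees only the concatenated output string. $\mathrm{Cap}(D)$ is its Shannon capacity per input bit, i.e. the supremum of rates of reliable communication, equal to $\lim_{n\to\infty}\frac1n\sup_{X^n}I(X^n;Y)$, where $X^n$ ranges over random $n$-bit inputs and $Y$ is the output string. $Y^{(q)}$ denotes the probability distribution on $\{1,2,\dots\}$ with mass $y_0q^y e^{\log (y-1)!-\Lambda_1(y)-\Lambda_2(y)-yh(p)}$ at $y$. *)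

(* Defs.v *)
From HB Require Import structures.
From mathcomp Require Import all_boot all_order all_algebra.
From mathcomp Require Import all_classical all_reals all_analysis.

Set Implicit Arguments.
Unset Strict Implicit.
Unset Printing Implicit Defensive.

Import Order.TTheory GRing.Theory Num.Theory.
Import numFieldNormedType.Exports.

Local Open Scope classical_set_scope.
Local Open Scope ring_scope.

(* Bit i of x is replaced by d_i copies of itself; only the concatenation is
   kept, so the boundaries between the copies are lost. *)
Definition repeat_output (n : nat) (x : n.-tuple bool) (d : n.-tuple nat) :
    seq bool :=
  flatten [seq nseq (tnth d i) (tnth x i) | i <- enum 'I_n].

(* Probability that the output string of the repeat channel on input x lies
   in E, where D is the probability mass function on nat of the replication
   counts: the total mass, under the i.i.d. law of (D_1, ..., D_n), of the
   replication vectors d that lead to an output in E. *)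
Definition repeat_channel (R : realType) (D : nat -> R) (n : nat)
    (x : n.-tuple bool) (E : set (seq bool)) : \bar R :=
  (\esum_(d in [set d : n.-tuple nat | E (repeat_output x d)])
     (\prod_(i < n) D (tnth d i))%:E)%E.

(* Error probability of a code with M equiprobable messages. *)
Definition avg_error (R : realType) (D : nat -> R) (n M : nat)
    (enc : 'I_M -> n.-tuple bool) (dec : seq bool -> 'I_M) : \bar R :=
  ((M%:R^-1)%:E *
   \sum_(m < M) repeat_channel D (enc m) [set y | dec y <> m])%E.

(* The rate r is in nats per input bit: codes of length n with at least
   exp(n r) messages. *)
Definition achievable_rate (R : realType) (D : nat -> R) (r : R) : Prop :=
  forall eps : R, 0 < eps -> exists N : nat, forall n : nat, (N <= n)%N ->
    exists (M : nat) (enc : 'I_M -> n.-tuple bool) (dec : seq bool -> 'I_M),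
      expR (n%:R * r) <= M%:R /\ (avg_error D enc dec <= eps%:E)%E.

Definition Cap (R : realType) (D : nat -> R) : \bar R :=
  ereal_sup [set r%:E | r in [set r : R | achievable_rate D r]].

Definition geometric_pmf (R : realType) (p : R) (y : nat) : R :=
  if y == 0%N then 0 else (1 - p) * p ^+ y.-1.

Definition binary_entropy (R : realType) (p : R) : R :=
  - p * ln p - (1 - p) * ln (1 - p).

(* The integrands below are bounded on ]0, 1[; their values at t = 0 and t = 1
   come from the conventions x / 0 = 0 and ln 0 = 0 and do not affect the
   integrals. *)
Definition Lambda1 (R : realType) (p : R) (y : nat) : R :=
  \int[lebesgue_measure]_(t in `[0, 1])
    ((1 + t - t * y%:R * (1 - p) - ((1 - t) / (1 - p * t)) ^+ y / (1 - t))
     / (t * ln (1 - t))).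

Definition Lambda2 (R : realType) (p : R) (y : nat) : R :=
  \int[lebesgue_measure]_(t in `[0, 1])
    ((1 - t * y%:R * p - (1 / (1 + p * t)) ^+ y) / (t * ln (1 - t))).

Definition Y_weight (R : realType) (p q : R) (y : nat) : R :=
  q ^+ y * expR (ln ((y.-1)`!)%:R - Lambda1 p y - Lambda2 p y
                 - y%:R * binary_entropy p).

Definition Y_norm (R : realType) (p q : R) : \bar R :=
  (\sum_(1 <= y <oo) (Y_weight p q y)%:E)%E.

(* Meaningful when Y_norm p q is finite. *)
Definition y0 (R : realType) (p q : R) : R := (fine (Y_norm p q))^-1.

(* When Y_norm p is finite on all of ]0, 1[, this is finite there too, because
   y * q ^+ y = O(r ^+ y) whenever q < r < 1. *)
Definition Y_mean (R : realType) (p q : R) : \bar R :=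
  (\sum_(1 <= y <oo) (y0 p q * y%:R * Y_weight p q y)%:E)%E.

Definition dual_inf (R : realType) (p mu : R) : \bar R :=
  ereal_inf [set (- ln (y0 p q) - mu * ln q)%:E | q in [set q : R | 0 < q < 1]].

Definition mu_bound (R : realType) (p : R) : \bar R :=
  ereal_sup [set (dual_inf p mu / (mu * (1 - p))%:E)%E
            | mu in [set mu : R | 1 / (1 - p) <= mu]].

Definition q_bound (R : realType) (p : R) : \bar R :=
  ereal_sup [set ((- ln (y0 p q) - fine (Y_mean p q) * ln q)
                  / (fine (Y_mean p q) * (1 - p)))%:E
            | q in [set q : R | 0 < q < 1 /\
                                ((1 / (1 - p))%:E <= Y_mean p q)%E]].

(* Main.v *)
Require Import Defs.
From HB Require Import structures.
From mathcomp Require Import all_boot all_order all_algebra.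
From mathcomp Require Import all_classical all_reals all_analysis.
From mathcomp Require Import measurable_realfun.
From mathcomp Require Import zify ring lra.

Set Implicit Arguments.
Unset Strict Implicit.
Unset Printing Implicit Defensive.

Import Order.TTheory GRing.Theory Num.Theory.
Import numFieldNormedType.Exports.

Local Open Scope classical_set_scope.
Local Open Scope ring_scope.

(** The channel maps a run of b equal bits to a run whose length Y is b plus a
    negative binomial variable, and preserves the number of runs.  From
    ln n! = \int_0^1 (1 - t n - (1 - t)^n) / (t ln (1 - t)) dt (Frullani) and
    the generating function of Y one gets E Lambda1(Y) = ln (b-1)! and
    E Lambda2(Y) = E ln (Y-b)!, so that the divergence of Y from Y^(q) is exactly
    - ln y0 - E[Y] ln q.

    Converse: the Donsker-Varadhan form of this identity tensorizes over the runs;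
    comparing the output with independent runs of law Y^(q) bounds the rate of a
    code by k (- ln y0) - n ln q / (1-p), up to O(ln n), where k is the mean
    number of runs of a codeword.  Put mu = n / ((1-p) k) and take the infimum
    over q.

    Finiteness of y0: the increments of Lambda1 and Lambda2 are Frullani-type
    integrals, and bounding them below shows that the logarithm of the weight of
    Y^(q) at y is at most y ln q + O(ln y).

    Second inequality: by Gibbs' inequality the weights from b on have mass at
    least q^(b/(1-p)), so the mean of Y^(q) exceeds any given mu for q near 1,
    and the intermediate value theorem gives some q with E[Y^(q)] = mu. *)

(** * Integrals over the unit interval and Frullani's integral *)

(** [Lambda1] and [Lambda2] arise by evaluating E s^Y = ((1-p) s / (1 - p s))^b at the s for which
    it becomes (1-t)^b, respectively E (1-t)^(Y-b). The term ln (y-1)! of the weight is the one in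
    the binomial coefficient of the law of Y, so its mean is never computed.

    The obstacle in the converse is that the output does not show which input run produced what, and
    that the comparison law depends on the codeword through its first bit and its number of runs.
    The proof therefore never speaks of entropy or mutual information of strings. It works with
    means of bounded functions of the concatenated output: the logarithm of a reference mean over
    the later runs serves as the test function for the first run, which gives the bound for all runs
    by induction.

    The bound for a code holds with the same k for every q. Hence mu depends on the code only and
    the infimum over q can be taken afterwards; k <= n is what gives mu >= 1/(1-p). *)

Lemma continuous_itvoo_measurable (R : realType) (a b : R) (f : R -> R) :
  (forall t : R, a < t < b -> {for t, continuous f}) ->
  measurable_fun (`]a, b[ : set R) (EFin \o f).
Proof.
move=> cf; apply/measurable_EFinP.
apply: open_continuous_measurable_fun => //.
by move=> t; rewrite inE/= in_itv/= => /cf.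
Qed.

(** Continuity and the bound are asked on the open interval only, because the integrands take
    default values at 0 and 1; these two values are absorbed in the constant. *)
Lemma bounded_integrable01 (R : realType) (f : R -> R) (C : R) :
  (forall t : R, 0 < t < 1 -> {for t, continuous f}) ->
  (forall t : R, 0 < t < 1 -> `|f t| <= C) ->
  (@lebesgue_measure R).-integrable `[0, 1] (EFin \o f).
Proof.
move=> cf bf.
have mf : measurable_fun (`[0, 1] : set R) f.
  apply/measurable_fun_itv_bndo_bndcP/measurable_fun_itv_obnd_cbndP.
  by apply/measurable_EFinP; exact: continuous_itvoo_measurable.
apply: (@measurable_bounded_integrable _ _ _ lebesgue_measure) => //.
  by rewrite /= lebesgue_measure_itv/= lte01 oppr0 adde0 ltry.
exists (Num.max C (Num.max `|f 0| `|f 1|)); split; first by rewrite num_real.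
move=> M CM t /=; rewrite in_itv/= => /andP[t0 t1].
apply: le_trans (ltW CM); rewrite !le_max.
move: t0; rewrite le_eqVlt => /predU1P[<-|t0]; first by rewrite lexx !orbT.
move: t1; rewrite le_eqVlt => /predU1P[->|t1]; first by rewrite lexx !orbT.
by rewrite bf// t0.
Qed.

Lemma continuous_integrable01 (R : realType) (f : R -> R) :
  (forall t : R, 0 <= t <= 1 -> {for t, continuous f}) ->
  (@lebesgue_measure R).-integrable `[0, 1] (EFin \o f).
Proof.
move=> cf; apply: continuous_compact_integrable; first exact: segment_compact.
by apply: continuous_in_subspaceT => t; rewrite inE/= in_itv/= => /cf.
Qed.

Lemma FTC01 (R : realType) (F f : R -> R) :
  (forall t : R, 0 <= t <= 1 -> is_derive t (1 : R) F (f t)) ->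
  (forall t : R, 0 <= t <= 1 -> {for t, continuous f}) ->
  \int[lebesgue_measure]_(t in `[0, 1]) f t = F 1 - F 0.
Proof.
move=> dF cf; rewrite /Rintegral (@continuous_FTC2 _ f F)//.
- by apply: continuous_in_subspaceT => t; rewrite inE/= in_itv/= => /cf.
- have cF t : 0 <= t <= 1 -> {for t, continuous F}.
    by move=> /dF df; apply: differentiable_continuous; apply/derivable1_diffP; exact: ex_derive.
  split.
  + move=> t; rewrite in_itv/= => /andP[t0 t1].
    by have := dF t; rewrite !ltW//= => /(_ isT) [].
  + by apply: cvg_at_right_filter; apply: cF; rewrite lexx ler01.
  + by apply: cvg_at_left_filter; apply: cF; rewrite lexx ler01.
- move=> t; rewrite in_itv/= => /andP[t0 t1].
  by rewrite derive1E; have := dF t; rewrite !ltW//= => /(_ isT) [_ ->].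
Qed.

Lemma oneminus_gt0 (R : realType) (t : R) : t < 1 -> 0 < 1 - t.
Proof. by rewrite subr_gt0. Qed.

Lemma ln1B_le (R : realType) (t : R) : t < 1 -> ln (1 - t) <= - t.
Proof.
move=> t1; by apply: le_ln1Dx; rewrite ltrN2.
Qed.

Lemma oppln1B_gt0 (R : realType) (t : R) : 0 < t < 1 -> 0 < - ln (1 - t).
Proof.
move=> /andP[t0 t1]; rewrite oppr_gt0; apply: (le_lt_trans (ln1B_le t1)).
by rewrite oppr_lt0.
Qed.

Lemma continuous_ln1B (R : realType) (t : R) : t < 1 ->
  {for t, continuous (fun t : R => ln (1 - t))}.
Proof.
move=> t1; apply: (@cvg_comp _ _ _ (fun t => 1 - t) (@ln R)).
  by apply: cvgB; [exact: cvg_cst|exact: cvg_id].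
by apply: continuous_ln; rewrite subr_gt0.
Qed.

Lemma integral_expR_line (R : realType) (L k : R) : L < 0 -> 0 < k ->
  (\int[lebesgue_measure]_(s in `[0%R, k]) (expR (s * L))%:E =
   ((1 - expR (k * L)) / - L)%:E)%E.
Proof.
move=> L0 k0.
have dF (s : R) : is_derive s (1 : R) (fun s => expR (s * L) / L) (expR (s * L)).
  have : is_derive s (1 : R) (fun s => expR (s * L) / L) (L^-1 *: (expR (s * L) *: L)).
    have -> : (fun s : R => expR (s * L) / L) = (L^-1 \*: (fun s => expR (s * L))).
      by apply/funext => u /=; rewrite mulrC.
    apply: is_deriveZ.
    have : is_derive s (1 : R) (fun s => s * L) L.
      have -> : (fun s : R => s * L) = (L \*: id) by apply/funext => u /=; rewrite mulrC.
      by apply: is_derive_eq; rewrite /GRing.scale/= mulr1.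
    move=> dL; apply: is_derive_eq; rewrite /GRing.scale/= ?mulr1; first by exact: erefl.
  by rewrite /GRing.scale/= mulrCA mulVf ?mulr1// lt_eqF.
have cF (f : R -> R) : (forall s : R, derivable f s 1) -> continuous f.
  by move=> df s; apply: differentiable_continuous; exact/derivable1_diffP.
rewrite (@continuous_FTC2 _ _ (fun s => expR (s * L) / L))//.
- rewrite mul0r expR0 -EFinB; congr EFin; rewrite -mulrBl invrN mulrN -mulNr; congr (_ / _); ring.
- apply: continuous_subspaceT => s.
  apply: (@cvg_comp _ _ _ (fun s => s * L) (@expR R)); last exact: continuous_expR.
  by apply: cvgM; [exact: cvg_id|exact: cvg_cst].
- have := cF _ (fun s => @ex_derive _ _ _ _ _ _ _ (dF s)) => c; split.
  + by move=> s _; exact: ex_derive.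
  + by apply: cvg_at_right_filter; exact: c.
  + by apply: cvg_at_left_filter; exact: c.
- by move=> s _; rewrite derive1E; have [_ ->] := dF s.
Qed.

Lemma integral_powR1B (R : realType) (s : R) : 0 < s ->
  (\int[lebesgue_measure]_(t in `[0%R, 1%R]) ((1 - t) `^ s)%:E = ((s + 1)^-1)%:E)%E.
Proof.
move=> s0; have s1 : 0 < s + 1 by rewrite addr_gt0.
have dP (r t : R) : t < 1 -> is_derive t (1 : R) (fun t : R => (1 - t) `^ r) (- (r * (1 - t) `^ (r - 1))).
  move=> t1; have t10 : 0 < 1 - t by rewrite subr_gt0.
  have dg : is_derive t (1 : R) (fun t : R => 1 - t) (-1).
    by have := is_deriveB (is_derive_cst (1 : R) t (1 : R)) (is_derive_id t (1 : R)); rewrite sub0r.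
  have := @is_derive1_comp _ (fun x => x `^ r) (fun t => 1 - t) t _ _ (is_derive1_powR r t10) dg.
  by rewrite mulrN1.
have cP (r t : R) : t < 1 -> {for t, continuous (fun t : R => (1 - t) `^ r)}.
  by move=> /(dP r) df; apply: differentiable_continuous; apply/derivable1_diffP; exact: ex_derive.
have cP1 (r : R) : 0 < r -> (fun t : R => (1 - t) `^ r) x @[x --> 1^'-] --> 0.
  move=> r0; apply/cvgrPdist_le => e e0; near=> x.
  have x1 : x < 1 by near: x; exact: nbhs_left_lt.
  rewrite sub0r normrN ger0_norm ?powR_ge0//.
  have -> : e = (e `^ r^-1) `^ r by rewrite -powRrM mulVf ?gt_eqF// powRr1// ltW.
  apply: ge0_ler_powR; rewrite ?nnegrE ?powR_ge0 ?ltW// ?subr_gt0//.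
  rewrite ltrBlDr -ltrBlDl; near: x; apply: nbhs_left_gt.
  by rewrite ltrBlDl ltrDr powR_gt0.
rewrite (@continuous_FTC2 _ _ (fun t => - ((1 - t) `^ (s + 1) / (s + 1))))//.
- by rewrite subrr subr0 powR0 ?gt_eqF// powR1 mul0r mul1r oppr0 -EFinB sub0r opprK.
- apply/continuous_within_itvP => //; split.
  + by move=> x; rewrite in_itv/= => /andP[_ x1]; exact: cP.
  + by apply: cvg_at_right_filter; apply: cP.
  + by rewrite subrr powR0 ?gt_eqF//; exact: cP1.
- split.
  + move=> x; rewrite in_itv/= => /andP[_ x1].
    by apply: derivableN; apply: derivableM => //; apply: ex_derive; exact: dP.
  + apply: cvg_at_right_filter; apply: cvgN; apply: cvgM; last exact: cvg_cst.
    exact: cP.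
  + rewrite subrr powR0 ?gt_eqF//; apply: cvgN; apply: cvgM; last exact: cvg_cst.
    exact: cP1.
- move=> t; rewrite in_itv/= => /andP[t0 t1]; rewrite derive1E.
  have -> : (fun t : R => - ((1 - t) `^ (s + 1) / (s + 1))) =
      ((- (s + 1)^-1) \*: (fun t : R => (1 - t) `^ (s + 1))).
    by apply/funext => u /=; rewrite mulrC /GRing.scale/= mulNr.
  have [_ ->] := is_deriveZ (- (s + 1)^-1) (dP (s + 1) t t1).
  by rewrite /GRing.scale/= mulrNN mulrA mulVf ?gt_eqF// mul1r addrK.
Unshelve. all: by end_near. Qed.

Lemma ftc_inv1D (R : realType) (k : R) : 0 < k ->
  (\int[lebesgue_measure]_(s in `[0%R, k]) ((s + 1)^-1)%:E = (ln (k + 1))%:E)%E.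
Proof.
move=> k0.
have dF (s : R) : -1 < s -> is_derive s (1 : R) (fun s => ln (s + 1)) ((s + 1)^-1).
  move=> s1; have s10 : 0 < s + 1 by lra.
  have := is_derive1_ln s10 => dl.
  have dg : is_derive s (1 : R) (fun s : R => s + 1) 1.
    by apply: is_derive_eq; rewrite addr0.
  have := @is_derive1_comp _ (@ln R) (fun s => s + 1) s _ _ dl dg.
  by rewrite mulr1.
have cF (s : R) : -1 < s -> {for s, continuous (fun s : R => ln (s + 1))}.
  by move=> /dF df; apply: differentiable_continuous; apply/derivable1_diffP; exact: ex_derive.
rewrite (@continuous_FTC2 _ _ (fun s => ln (s + 1)))//.
- by rewrite add0r ln1 sube0.
- apply: continuous_in_subspaceT => s; rewrite inE/= in_itv/= => /andP[s0 _].
  apply: cvgV; first by rewrite gt_eqF// ltr_wpDl.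
  by apply: cvgD; [exact: cvg_id|exact: cvg_cst].
- split.
  + by move=> s; rewrite in_itv/= => /andP[s0 _]; apply: ex_derive; apply: dF; lra.
  + by apply: cvg_at_right_filter; apply: cF; lra.
  + by apply: cvg_at_left_filter; apply: cF; lra.
- move=> s; rewrite in_itv/= => /andP[s0 _]; rewrite derive1E.
  by have [|_ ->] := dF s; first lra.
Qed.

(* Frullani's integral, by writing the integrand as the integral of (1-t)^s over s in [0, k]. *)
Lemma frullani (R : realType) (k : R) : 0 < k ->
  \int[lebesgue_measure]_(t in `[0, 1]) ((1 - expR (k * ln (1 - t))) / - ln (1 - t)) = ln (k + 1).
Proof.
move=> k0.
pose g (s t : R) : R := expR (s * ln (1 - t)).
(* The indicators move both domains into the integrand, so that Tonelli's theorem can be used on the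
   whole plane. *)
pose f (z : measurableTypeR R * measurableTypeR R) : \bar R :=
  (\1_(`]0%R, 1%R[ : set R) z.1 * \1_(`]0%R, k[ : set R) z.2 * g z.2 z.1)%:E.
have mg : measurable_fun setT (fun z : measurableTypeR R * measurableTypeR R => g z.2 z.1).
  apply: measurableT_comp; first exact: measurable_expR.
  apply: measurable_funM => //; apply: measurableT_comp; first exact: measurable_ln.
  by apply: measurable_funB.
have mf : measurable_fun setT f.
  apply/measurable_EFinP; apply: measurable_funM => //; apply: measurable_funM.
    by apply: measurableT_comp => //; exact: measurable_indic.
  by apply: measurableT_comp => //; exact: measurable_indic.
have f0 z : (0 <= f z)%E by rewrite lee_fin !mulr_ge0 ?expR_ge0.
have := fubini_tonelli (m1 := @lebesgue_measure R) (m2 := @lebesgue_measure R) f mf f0.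
have mgs t : measurable_fun setT (g^~ t).
  by apply: measurableT_comp; [exact: measurable_expR|exact: measurable_funM].
have mgt s : measurable_fun setT (g s).
  apply: measurableT_comp; first exact: measurable_expR.
  apply: measurable_funM => //; apply: measurableT_comp; first exact: measurable_ln.
  by apply: measurable_funB.
have rw (A : set (measurableTypeR R)) (h : R -> R) :
    (\int[lebesgue_measure]_x (\1_A x * h x)%:E = \int[lebesgue_measure]_(x in A) (h x)%:E)%E.
  rewrite [RHS]integral_mkcond; apply: eq_integral => x _; rewrite /patch indicE.
  by case: (x \in A); rewrite ?mul1r ?mul0r.
have oo (x y : R) (h : R -> R) : measurable_fun setT h ->
    (\int[lebesgue_measure]_(z in `]x, y[) (h z)%:E = \int[lebesgue_measure]_(z in `[x, y]) (h z)%:E)%E.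
  by move=> mh; rewrite [RHS]integral_itv_bndoo//; apply/measurable_EFinP; apply: measurable_funTS.
have -> : (\int[lebesgue_measure]_x \int[lebesgue_measure]_y f (x, y) =
    \int[lebesgue_measure]_(t in `[0%R, 1%R]) ((1 - expR (k * ln (1 - t))) / - ln (1 - t))%:E)%E.
  rewrite [RHS]integral_itv_bndoo; last first.
    apply: continuous_itvoo_measurable => t t01; have /andP[t0 t1] := t01.
    apply: cvgM.
      apply: cvgB; first exact: cvg_cst.
      apply: (@cvg_comp _ _ _ (fun t => k * ln (1 - t)) (@expR R)); last exact: continuous_expR.
      by apply: cvgM; [exact: cvg_cst|exact: continuous_ln1B].
    apply: cvgV; first by rewrite gt_eqF// oppln1B_gt0.
    by apply: cvgN; exact: continuous_ln1B.
  rewrite [RHS]integral_mkcond; apply: eq_integral => t _; rewrite /patch.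
  rewrite /f/= indicE; case: ifPn => t01; last first.
    by apply: integral0_eq => s _; rewrite !mul0r.
  under eq_integral do rewrite mul1r.
  rewrite rw // oo // integral_expR_line//.
  move: t01; rewrite inE/= in_itv/= => t01.
  by rewrite -oppr_gt0; exact: oppln1B_gt0.
have -> : (\int[lebesgue_measure]_y \int[lebesgue_measure]_x f (x, y) = (ln (k + 1))%:E)%E.
  rewrite -ftc_inv1D// [RHS]integral_itv_bndoo; last first.
    apply: continuous_itvoo_measurable => s /andP[s0 _].
    apply: cvgV; first by rewrite gt_eqF// addr_gt0.
    by apply: cvgD; [exact: cvg_id|exact: cvg_cst].
  rewrite [RHS]integral_mkcond; apply: eq_integral => s _; rewrite /patch.
  rewrite /f/= indicE; case: ifPn => t01; last first.
    by apply: integral0_eq => t _; rewrite mulr0 mul0r.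
  under eq_integral do rewrite mulr1.
  move: t01; rewrite inE/= in_itv/= => /andP[s0 _].
  (* At t = 1 the default [ln 0 = 0] makes [g] equal to 1, while the power of base 0 is 0; on the
     open interval the two agree. *)
  rewrite rw //; rewrite -integral_powR1B// [RHS]integral_itv_bndoo; last first.
    apply/measurable_EFinP/measurable_funTS.
    apply: (@measurableT_comp _ _ _ _ _ _ (fun x : R => x `^ s) _ (fun t : R => 1 - t)); first exact: measurable_powR.
    by apply: measurable_funB.
  apply: eq_integral => t; rewrite inE/= in_itv/= => /andP[t0 t1].
  by rewrite /g /powR subr_eq0 gt_eqF.
by rewrite /Rintegral => ->.
Qed.

(** * The integrands of ln n!, Lambda1 and Lambda2 *)

Lemma ge_Rintegral01 (R : realType) (f g : R -> R) :
  (@lebesgue_measure R).-integrable `[0, 1] (EFin \o f) ->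
  (@lebesgue_measure R).-integrable `[0, 1] (EFin \o g) ->
  (forall t, 0 < t < 1 -> f t <= g t) ->
  \int[lebesgue_measure]_(t in `[0, 1]) f t <= \int[lebesgue_measure]_(t in `[0, 1]) g t.
Proof.
move=> intf intg fg.
have oo (h : R -> R) : (@lebesgue_measure R).-integrable `[0, 1] (EFin \o h) ->
    \int[lebesgue_measure]_(t in `[0, 1]) h t = \int[lebesgue_measure]_(t in `]0, 1[) h t.
  move=> inth; rewrite /Rintegral integral_itv_bndoo//.
  have /integrableP[mh _] := inth.
  by apply: measurable_funS mh => //; exact: subset_itv_oo_cc.
rewrite !oo//; apply: le_Rintegral => //.
- by apply: integrableS intf => //; exact: subset_itv_oo_cc.
- by apply: integrableS intg => //; exact: subset_itv_oo_cc.
Qed.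

Lemma eq_Rintegral01 (R : realType) (f g : R -> R) :
  (@lebesgue_measure R).-integrable `[0, 1] (EFin \o f) ->
  (@lebesgue_measure R).-integrable `[0, 1] (EFin \o g) ->
  (forall t, 0 < t < 1 -> f t = g t) ->
  \int[lebesgue_measure]_(t in `[0, 1]) f t = \int[lebesgue_measure]_(t in `[0, 1]) g t.
Proof.
move=> intf intg fg; apply/eqP; rewrite eq_le.
by rewrite !ge_Rintegral01// => t t01; rewrite fg.
Qed.

Lemma Rintegral01D (R : realType) (f g : R -> R) :
  (@lebesgue_measure R).-integrable `[0, 1] (EFin \o f) ->
  (@lebesgue_measure R).-integrable `[0, 1] (EFin \o g) ->
  \int[lebesgue_measure]_(t in `[0, 1]) (f t + g t) =
  \int[lebesgue_measure]_(t in `[0, 1]) f t + \int[lebesgue_measure]_(t in `[0, 1]) g t.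
Proof. by move=> intf intg; rewrite RintegralD. Qed.

Lemma Rintegral01B (R : realType) (f g : R -> R) :
  (@lebesgue_measure R).-integrable `[0, 1] (EFin \o f) ->
  (@lebesgue_measure R).-integrable `[0, 1] (EFin \o g) ->
  \int[lebesgue_measure]_(t in `[0, 1]) (f t - g t) =
  \int[lebesgue_measure]_(t in `[0, 1]) f t - \int[lebesgue_measure]_(t in `[0, 1]) g t.
Proof. by move=> intf intg; rewrite RintegralB. Qed.

Lemma Rintegral01Z (R : realType) (c : R) (f : R -> R) :
  (@lebesgue_measure R).-integrable `[0, 1] (EFin \o f) ->
  \int[lebesgue_measure]_(t in `[0, 1]) (c * f t) =
  c * \int[lebesgue_measure]_(t in `[0, 1]) f t.
Proof. by move=> intf; rewrite RintegralZl. Qed.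

Lemma integrable01D (R : realType) (f g : R -> R) :
  (@lebesgue_measure R).-integrable `[0, 1] (EFin \o f) ->
  (@lebesgue_measure R).-integrable `[0, 1] (EFin \o g) ->
  (@lebesgue_measure R).-integrable `[0, 1] (EFin \o (fun t => f t + g t)).
Proof. by move=> intf intg; have := integrableD _ intf intg; apply. Qed.

Lemma integrable01B (R : realType) (f g : R -> R) :
  (@lebesgue_measure R).-integrable `[0, 1] (EFin \o f) ->
  (@lebesgue_measure R).-integrable `[0, 1] (EFin \o g) ->
  (@lebesgue_measure R).-integrable `[0, 1] (EFin \o (fun t => f t - g t)).
Proof. by move=> intf intg; have := integrableB _ intf intg; apply. Qed.

Lemma integrable01Z (R : realType) (c : R) (f : R -> R) :
  (@lebesgue_measure R).-integrable `[0, 1] (EFin \o f) ->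
  (@lebesgue_measure R).-integrable `[0, 1] (EFin \o (fun t => c * f t)).
Proof. by move=> intf; have := @integrableZl _ _ _ lebesgue_measure _ _ c _ intf; apply. Qed.

Lemma cvg_expr (R : realType) (f : R -> R) (t : R) n :
  {for t, continuous f} -> {for t, continuous (fun t => f t ^+ n)}.
Proof.
by move=> cf; apply: (@cvg_comp _ _ _ f (fun x => x ^+ n)); [exact: cf|exact: exprn_continuous].
Qed.

Lemma continuous_affine (R : realType) (b c : R) : continuous (fun t : R => b + c * t).
Proof.
move=> t; apply: cvgD; first exact: cvg_cst.
by apply: cvgM; [exact: cvg_cst|exact: cvg_id].
Qed.

(** The second-order control makes the numerators of the integrands O(t^2), to match the double zero
    of t ln (1 - t) at 0. The crude factor n^2 is harmless: it is later dominated by a second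
    moment. *)
Lemma expr1B_bounds (R : realType) (u : R) n : 0 <= u <= 1 ->
  1 - n%:R * u <= (1 - u) ^+ n <= 1 - n%:R * u + n%:R ^+ 2 * u ^+ 2.
Proof.
move=> /andP[u0 u1]; elim: n => [|n /andP[l r]].
  by rewrite !mul0r expr0 subr0 lexx/= expr0n/= mul0r addr0.
have n0 : 0 <= n%:R :> R by [].
have v0 : 0 <= 1 - u by lra.
rewrite exprS -natr1; move: (n%:R : R) ((1 - u) ^+ n) n0 l r => x z x0 l r.
have h1 := ler_wpM2l v0 l; have h2 := ler_wpM2l v0 r.
have u2 : 0 <= u ^+ 2 by rewrite exprn_ge0.
have h3 : 0 <= x * u ^+ 2 by rewrite mulr_ge0.
have h4 : 0 <= x ^+ 2 * u ^+ 3 by rewrite mulr_ge0 ?exprn_ge0.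
by apply/andP; split; nra.
Qed.

Lemma ln1B_ge (R : realType) (t : R) : t < 1 -> t <= - ln (1 - t).
Proof. by move=> t1; rewrite lerNr; exact: ln1B_le. Qed.

Lemma frullani_nat (R : realType) (k : nat) :
  \int[lebesgue_measure]_(t in `[0, 1]) ((1 - (1 - t) ^+ k) / - ln (1 - t)) = ln k.+1%:R :> R.
Proof.
case: k => [|k].
  under eq_Rintegral do rewrite expr0 subrr mul0r.
  by rewrite Rintegral_cst// mul0r ln1.
rewrite -[in RHS]natr1 -frullani//; apply: eq_Rintegral => t.
rewrite inE/= in_itv/= => /andP[t0]; rewrite le_eqVlt => /predU1P[->|t1].
  by rewrite subrr ln0// oppr0 invr0 !mulr0.
by rewrite expRM_natl lnK// posrE subr_gt0.
Qed.

Lemma frullani_integrable (R : realType) (c : R) (v : R -> R) :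
  (forall t, 0 < t < 1 -> {for t, continuous v}) ->
  (forall t, 0 < t < 1 -> `|1 - v t| <= c * t) ->
  (@lebesgue_measure R).-integrable `[0, 1] (EFin \o (fun t => (1 - v t) / - ln (1 - t))).
Proof.
move=> cv bv; apply: (@bounded_integrable01 _ _ c) => t t01; have /andP[t0 t1] := t01.
  apply: cvgM; first by apply: cvgB; [exact: cvg_cst|exact: cv].
  apply: cvgV; first by rewrite gt_eqF// oppln1B_gt0.
  by apply: cvgN; exact: continuous_ln1B.
have l0 := oppln1B_gt0 t01.
rewrite normrM normfV (gtr0_norm l0) ler_pdivrMr//.
apply: (le_trans (bv _ t01)); apply: ler_wpM2l; last exact: ln1B_ge.
have := le_trans (normr_ge0 _) (bv _ t01).
by rewrite pmulr_lge0.
Qed.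

(** Since t <= - ln (1 - t), the denominator is at least t^2 in absolute value. *)
Lemma quotient_bound (R : realType) (c t N : R) : 0 < t < 1 ->
  `|N| <= c * t ^+ 2 -> `|N / (t * ln (1 - t))| <= c.
Proof.
move=> t01 Nc; have /andP[t0 t1] := t01; have l0 := oppln1B_gt0 t01.
have tl : 0 < t * - ln (1 - t) by rewrite mulr_gt0.
rewrite -normrN -mulrN -invrN -mulrN normrM normfV (gtr0_norm tl) ler_pdivrMr//.
apply: (le_trans Nc).
have c0 : 0 <= c by have := le_trans (normr_ge0 _) Nc; rewrite pmulr_lge0// exprn_gt0.
by apply: ler_wpM2l => //; rewrite expr2 ler_pM2l// ln1B_ge.
Qed.

Lemma quotient_integrable (R : realType) (c : R) (N : R -> R) :
  (forall t, 0 < t < 1 -> {for t, continuous N}) ->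
  (forall t, 0 < t < 1 -> `|N t| <= c * t ^+ 2) ->
  (@lebesgue_measure R).-integrable `[0, 1] (EFin \o (fun t => N t / (t * ln (1 - t)))).
Proof.
move=> cN bN; apply: (@bounded_integrable01 _ _ c) => t t01; have /andP[t0 t1] := t01; last first.
  by apply: quotient_bound => //; exact: bN.
have l0 := oppln1B_gt0 t01.
apply: cvgM; first exact: cN.
apply: cvgV; first by apply: mulf_neq0; [rewrite gt_eqF|rewrite lt_eqF// -oppr_gt0].
by apply: cvgM; [exact: cvg_id|exact: continuous_ln1B].
Qed.

(** The numerator in Malmsten's integral for the logarithm of the gamma function, after the
    substitution exp (- u) = 1 - t. *)
Definition gamma_num (R : realType) (n : nat) (t : R) := 1 - t * n%:R - (1 - t) ^+ n.
Definition Lambda1_num (R : realType) (p : R) (y : nat) (t : R) :=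
  1 + t - t * y%:R * (1 - p) - ((1 - t) / (1 - p * t)) ^+ y / (1 - t).
Definition Lambda2_num (R : realType) (p : R) (y : nat) (t : R) :=
  1 - t * y%:R * p - (1 / (1 + p * t)) ^+ y.

Lemma gamma_num_bound (R : realType) n (t : R) : 0 < t < 1 ->
  `|gamma_num n t| <= n%:R ^+ 2 * t ^+ 2.
Proof.
move=> /andP[t0 t1]; have /(expr1B_bounds n)/andP[l r] : 0 <= t <= 1 by rewrite !ltW.
rewrite ler_norml /gamma_num; apply/andP; split; nra.
Qed.

Lemma Lambda2_num_bound (R : realType) (p : R) y (t : R) : 0 < p < 1 -> 0 < t < 1 ->
  `|Lambda2_num p y t| <= 2 * y%:R ^+ 2 * t ^+ 2.
Proof.
move=> /andP[p0 p1] /andP[t0 t1].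
have pt0 : 0 < p * t by rewrite mulr_gt0.
have ptt : p * t <= t by rewrite ler_piMl// ltW.
(* [1 - u] is the base of the power in [Lambda2_num], and u differs from p t by at most t^2. *)
set u := p * t / (1 + p * t).
have q0 : 0 < 1 + p * t by lra.
have uE : u * (1 + p * t) = p * t by rewrite /u divfK// gt_eqF.
have u0 : 0 <= u by rewrite divr_ge0// ltW.
have u1 : u <= p * t by nra.
have u2 : p * t - t ^+ 2 <= u by nra.
rewrite /Lambda2_num; have -> : 1 / (1 + p * t) = 1 - u by rewrite /u; field; rewrite gt_eqF.
have /(expr1B_bounds y)/andP[l r] : 0 <= u <= 1 by rewrite u0/=; lra.
have yy : y%:R <= y%:R ^+ 2 :> R by rewrite -natrX ler_nat; case: (y) => // m; rewrite -mulnn leq_pmulr.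
have y0 : 0 <= y%:R :> R by [].
have uu : u ^+ 2 <= t ^+ 2 by rewrite !expr2 ler_pM//; lra.
rewrite ler_norml; move: (y%:R : R) y0 yy l r => x x0 xx l r.
have h1 : x ^+ 2 * u ^+ 2 <= x ^+ 2 * t ^+ 2 by rewrite ler_wpM2l ?exprn_ge0.
have h2 : x * (p * t - t ^+ 2) <= x * u by rewrite ler_wpM2l.
have h3 : x * u <= x * (p * t) by rewrite ler_wpM2l.
have h4 : x * t ^+ 2 <= x ^+ 2 * t ^+ 2 by rewrite ler_wpM2r ?exprn_ge0// ltW.
have h5 : 0 <= x ^+ 2 * t ^+ 2 by rewrite mulr_ge0 ?exprn_ge0// ltW.
apply/andP; split; nra.
Qed.

(** The index [y.+1] leaves one factor 1 - t to cancel the division by 1 - t, which would be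
    unbounded at y = 0. After multiplication by b = 1 - p t the estimate costs (1 - p)^-2, and
    dividing by b again costs one more factor. *)
Lemma Lambda1_num_bound (R : realType) (p : R) y (t : R) : 0 < p < 1 -> 0 < t < 1 ->
  `|Lambda1_num p y.+1 t| <= (1 - p) ^- 3 * y.+1%:R ^+ 2 * t ^+ 2.
Proof.
move=> /andP[p0 p1] /andP[t0 t1].
set a := 1 - p; have a0 : 0 < a by rewrite /a; lra.
have pt0 : 0 < p * t by rewrite mulr_gt0.
have ptp : p * t < p by rewrite gtr_pMr.
set b := 1 - p * t; have b0 : a < b by rewrite /a /b; lra.
have b1 : b <= 1 by rewrite /b; lra.
have bp : 0 < b by lra.
set u := a * t / b.
have uE : u * b = a * t by rewrite /u divfK// gt_eqF.
have sE : (1 - t) / b = 1 - u by rewrite /u /a /b; field; rewrite gt_eqF.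
have u0 : 0 <= u by rewrite divr_ge0// ltW// mulr_gt0.
have : 0 <= (1 - t) / b by apply: divr_ge0; lra.
rewrite sE subr_ge0 => u1.
have ut : a * u <= a * t by nra.
have utt : u <= a^-1 * t by rewrite [leRHS]mulrC ler_pdivlMr//; nra.
have /(expr1B_bounds y)/andP[l r] : 0 <= u <= 1 by rewrite u0/=.
have NE : Lambda1_num p y.+1 t = (1 + t - t * y.+1%:R * a) - (1 - u) ^+ y / b.
  rewrite /Lambda1_num -/a -/b sE exprS; congr (_ - _).
  by rewrite -sE; field; rewrite !gt_eqF//; lra.
rewrite NE -natr1; have y0 : 0 <= y%:R :> R by [].
have bN : b * (1 + t - t * (y%:R + 1) * a - (1 - u) ^+ y / b) =
    (1 - y%:R * u - (1 - u) ^+ y) - (p * t) ^+ 2 + y%:R * (u - a * t * b).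
  have -> : b * (1 + t - t * (y%:R + 1) * a - (1 - u) ^+ y / b) =
     b * (1 + t - t * (y%:R + 1) * a) - (1 - u) ^+ y by field; rewrite gt_eqF.
  by rewrite /a /b; ring.
rewrite -(ler_pM2l bp) -[X in X * `|_|](gtr0_norm bp) -normrM bN.
have ai : a^-1 * a = 1 by rewrite mulVf// gt_eqF.
set c := a^-1 in utt ai *; have c0 : 0 < c by rewrite invr_gt0.
have c1 : 1 <= c by rewrite invf_ge1//; rewrite /a; lra.
have -> : (a ^+ 3)^-1 = c ^+ 3 by rewrite exprVn.
move: (y%:R : R) y0 l r {NE bN} => x x0 l r; set z := (1 - u) ^+ y in l r *.
have t20 : 0 <= t ^+ 2 by rewrite exprn_ge0// ltW.
have B1 : x ^+ 2 * u ^+ 2 <= x ^+ 2 * (c ^+ 2 * t ^+ 2).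
  rewrite ler_wpM2l ?exprn_ge0// -exprMn lerXn2r// nnegrE// mulr_ge0 ?ltW//.
have pt2 : 0 <= (p * t) ^+ 2 <= t ^+ 2.
  apply/andP; split; first by rewrite exprn_ge0// ltW.
  by rewrite !expr2; apply: ler_pM; rewrite ?(ltW pt0)//; nra.
have d0 : 0 <= u - a * t * b.
  by rewrite -uE -mulrA -[X in X - _]mulr1 -mulrBr mulr_ge0//; nra.
have d1 : u - a * t * b <= c * (2 * t ^+ 2).
  rewrite -uE -mulrA -[X in X - _]mulr1 -mulrBr.
  have h : 1 - b * b <= 2 * t by rewrite /b; nra.
  apply: (@le_trans _ _ (u * (2 * t))); first by rewrite ler_wpM2l.
  have := ler_wpM2r (ltW t0) utt; nra.
have e0 : 0 <= x * (u - a * t * b) by rewrite mulr_ge0.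
have e1 : x * (u - a * t * b) <= x * (c * (2 * t ^+ 2)) by rewrite ler_wpM2l.
have bc : 1 <= b * c by rewrite -ai mulrC ler_wpM2r ?ltW.
have K : c ^+ 2 * ((x + 1) ^+ 2 * t ^+ 2) <= b * (c ^+ 3 * (x + 1) ^+ 2 * t ^+ 2).
  have : 0 <= c ^+ 2 * ((x + 1) ^+ 2 * t ^+ 2) by rewrite !mulr_ge0 ?exprn_ge0 ?ltW//; lra.
  move=> /(ler_wpM2r)/(_ _ _ bc); nra.
apply: le_trans K.
have cc : c <= c ^+ 2 by nra.
have f1 : x * (c * t ^+ 2) <= x * (c ^+ 2 * t ^+ 2) by rewrite ler_wpM2l// ler_wpM2r.
have f2 : t ^+ 2 <= c ^+ 2 * t ^+ 2 by rewrite ler_peMl//; nra.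
have f3 : 0 <= x ^+ 2 * (c ^+ 2 * t ^+ 2) by rewrite !mulr_ge0 ?exprn_ge0// ltW.
have f4 : 0 <= x * (c ^+ 2 * t ^+ 2) by rewrite !mulr_ge0 ?exprn_ge0// ltW.
have -> : c ^+ 2 * ((x + 1) ^+ 2 * t ^+ 2) = x ^+ 2 * (c ^+ 2 * t ^+ 2) + 2 * (x * (c ^+ 2 * t ^+ 2)) + c ^+ 2 * t ^+ 2 by ring.
rewrite ler_norml; apply/andP; split; lra.
Qed.

Lemma gamma_integrable (R : realType) n :
  (@lebesgue_measure R).-integrable `[0, 1]
    (EFin \o (fun t => gamma_num n t / (t * ln (1 - t)))).
Proof.
apply: (@quotient_integrable _ (n%:R ^+ 2)) => t t01; last exact: gamma_num_bound.
apply: cvgB; last by apply: (@cvg_expr _ (fun t => 1 - t)); apply: cvgB; [exact: cvg_cst|exact: cvg_id].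
by apply: cvgB; [exact: cvg_cst|apply: cvgM; [exact: cvg_id|exact: cvg_cst]].
Qed.

Lemma Lambda1_integrable (R : realType) (p : R) y : 0 < p < 1 ->
  (@lebesgue_measure R).-integrable `[0, 1]
    (EFin \o (fun t => Lambda1_num p y.+1 t / (t * ln (1 - t)))).
Proof.
move=> p01; have /andP[p0 p1] := p01.
apply: (@quotient_integrable _ ((1 - p) ^- 3 * y.+1%:R ^+ 2)) => t t01; last exact: Lambda1_num_bound.
have /andP[t0 t1] := t01.
have c1 : {for t, continuous (fun t : R => 1 - t)} by apply: cvgB; [exact: cvg_cst|exact: cvg_id].
apply: cvgB.
  apply: cvgB; first by apply: cvgD; [exact: cvg_cst|exact: cvg_id].
  by apply: cvgM; [apply: cvgM; [exact: cvg_id|exact: cvg_cst]|exact: cvg_cst].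
apply: cvgM; last by apply: cvgV => //; rewrite subr_eq0 gt_eqF.
apply: (@cvg_expr _ (fun t => (1 - t) / (1 - p * t))); apply: cvgM => //; apply: cvgV; first by rewrite gt_eqF// subr_gt0; nra.
apply: cvgB; [exact: cvg_cst|apply: cvgM; [exact: cvg_cst|exact: cvg_id]].
Qed.

Lemma Lambda2_integrable (R : realType) (p : R) y : 0 < p < 1 ->
  (@lebesgue_measure R).-integrable `[0, 1]
    (EFin \o (fun t => Lambda2_num p y t / (t * ln (1 - t)))).
Proof.
move=> p01; have /andP[p0 p1] := p01.
apply: (@quotient_integrable _ (2 * y%:R ^+ 2)) => t t01; last exact: Lambda2_num_bound.
have /andP[t0 t1] := t01.
apply: cvgB.
  apply: cvgB; first exact: cvg_cst.
  by apply: cvgM; [apply: cvgM; [exact: cvg_id|exact: cvg_cst]|exact: cvg_cst].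
apply: (@cvg_expr _ (fun t => 1 / (1 + p * t))); apply: cvgM; first exact: cvg_cst.
apply: cvgV; last exact: continuous_affine.
by rewrite gt_eqF// addr_gt0// mulr_gt0.
Qed.

(* Both sides vanish at t = 1, where ln 0 = 0. *)
Lemma gamma_integral (R : realType) n :
  \int[lebesgue_measure]_(t in `[0, 1]) (gamma_num n t / (t * ln (1 - t))) = ln n`!%:R :> R.
Proof.
elim: n => [|n IH].
  under eq_Rintegral do rewrite /gamma_num expr0 mulr0 subr0 subrr mul0r.
  by rewrite Rintegral_cst// mul0r ln1.
(* The numerators for n + 1 and n differ by - t (1 - (1 - t)^n), so the integrals differ by
   Frullani's integral ln (n + 1). *)
rewrite factS natrM lnM ?posrE ?ltr0n ?fact_gt0// -IH -frullani_nat -Rintegral01D.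
- apply: eq_Rintegral => t; rewrite inE/= in_itv/= => /andP[].
  rewrite le_eqVlt => /predU1P[<- _|t0].
    by rewrite !mul0r invr0 !mulr0 subr0 expr1n subrr mul0r addr0.
  rewrite le_eqVlt => /predU1P[->|t1].
    by rewrite subrr ln0// mulr0 oppr0 invr0 !mulr0 addr0.
  have l0 : 0 < - ln (1 - t) by rewrite oppln1B_gt0 ?t0.
  rewrite /gamma_num exprS -natr1; field.
  by rewrite lt_eqF -?oppr_gt0// gt_eqF.
- apply: (@frullani_integrable _ n%:R) => t t01.
    by apply: (@cvg_expr _ (fun t => 1 - t)); apply: cvgB; [exact: cvg_cst|exact: cvg_id].
  have /andP[t0 t1] := t01.
  have /(expr1B_bounds n)/andP[l _] : 0 <= t <= 1 by rewrite !ltW.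
  have := exprn_ile1 n (ltW (oneminus_gt0 t1)); rewrite lerBlDr lerDl ltW// => /(_ isT) h.
  by rewrite ger0_norm ?subr_ge0//; lra.
- exact: gamma_integrable.
Qed.

Lemma affine_der (R : realType) (b c t : R) : is_derive t (1 : R) (fun t => b + c * t) c.
Proof.
have -> : (fun t => b + c * t) = (cst b + (c \*: id)) by apply/funext.
by apply: is_derive_eq; rewrite add0r /GRing.scale/= mulr1.
Qed.

Lemma affine_gt0 (R : realType) (b c t : R) : 0 < b -> 0 < b + c -> 0 <= t <= 1 ->
  0 < b + c * t.
Proof.
move=> b0 bc0 /andP[t0]; rewrite le_eqVlt => /predU1P[->|t1]; first by rewrite mulr1.
have h1 : 0 < (1 - t) * b by rewrite mulr_gt0// subr_gt0.
have h2 : 0 <= t * (b + c) by rewrite mulr_ge0// ltW.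
nra.
Qed.

Lemma FTC01_affine (R : realType) (F f : R -> R) (b c : R) :
  (forall t, 0 <= t <= 1 -> is_derive (b + c * t) (1 : R) F (f (b + c * t))) ->
  (forall t, 0 <= t <= 1 -> {for b + c * t, continuous f}) ->
  \int[lebesgue_measure]_(t in `[0, 1]) (f (b + c * t) * c) = F (b + c) - F b.
Proof.
move=> dF cf; transitivity (F (b + c * 1) - F (b + c * 0)); last by rewrite mulr1 mulr0 addr0.
apply: (@FTC01 _ (fun t => F (b + c * t))).
- move=> t t01; exact: (@is_derive1_comp _ F (fun t => b + c * t) t _ _ (dF t t01) (affine_der b c t)).
- move=> t t01; apply: cvgM; last exact: cvg_cst.
  apply: (@cvg_comp _ _ _ (fun t => b + c * t) f); [exact: continuous_affine|exact: cf].
Qed.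

Lemma integral_expr_affine (R : realType) (b c : R) k :
  \int[lebesgue_measure]_(t in `[0, 1]) ((b + c * t) ^+ k * c) =
  ((b + c) ^+ k.+1 - b ^+ k.+1) / k.+1%:R.
Proof.
rewrite mulrBl; apply: (@FTC01_affine _ (fun x => x ^+ k.+1 / k.+1%:R) (fun x => x ^+ k)).
- move=> t _; set x := b + c * t.
  have -> : (fun x : R => x ^+ k.+1 / k.+1%:R) = (k.+1%:R^-1 \*: (id ^+ k.+1)).
    by rewrite exprfctE; apply/funext => y /=; rewrite mulrC.
  apply: is_derive_eq; rewrite /GRing.scale/= mulr1 mulrA mulVf ?mul1r//.
- by move=> t _; exact: exprn_continuous.
Qed.

Lemma integral_inv_affine (R : realType) (b c : R) : 0 < b -> 0 < b + c ->
  \int[lebesgue_measure]_(t in `[0, 1]) ((b + c * t)^-1 * c) = ln (b + c) - ln b.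
Proof.
move=> b0 bc0.
have pos t : 0 <= t <= 1 -> 0 < b + c * t by exact: affine_gt0.
apply: (@FTC01_affine _ (@ln R) (fun x => x^-1)) => t /pos q0; first exact: is_derive1_ln.
by apply: cvgV; [rewrite gt_eqF|exact: cvg_id].
Qed.

Lemma integral_invX_affine (R : realType) (b c : R) k : 0 < b -> 0 < b + c ->
  \int[lebesgue_measure]_(t in `[0, 1]) ((b + c * t)^-1 ^+ k.+2 * c) =
  (b^-1 ^+ k.+1 - (b + c)^-1 ^+ k.+1) / k.+1%:R.
Proof.
move=> b0 bc0.
have pos t : 0 <= t <= 1 -> 0 < b + c * t by exact: affine_gt0.
have -> (u v : R) : (u - v) / k.+1%:R = - (k.+1%:R^-1 * v) - - (k.+1%:R^-1 * u) by ring.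
apply: (@FTC01_affine _ (fun x => - (k.+1%:R^-1 * x^-1 ^+ k.+1)) (fun x => x^-1 ^+ k.+2)).
- move=> t /pos; move: (b + c * t) => x x0.
  have xn : x != 0 by rewrite gt_eqF.
  have dV : is_derive x (1 : R) (fun x : R => x^-1) (- x ^- 2).
    by have := is_deriveV xn (is_derive_id x (1 : R)); rewrite /GRing.scale/= mulr1.
  have -> : (fun x : R => - (k.+1%:R^-1 * x^-1 ^+ k.+1)) = - (k.+1%:R^-1 \*: ((fun x => x^-1) ^+ k.+1)).
    by rewrite exprfctE; apply/funext.
  apply: is_derive_eq; rewrite /GRing.scale/=.
  rewrite -(mulrA k.+1%:R) mulKf// mulrN opprK -exprVn -exprD addn2 //.
- move=> t /pos q0; apply: (@cvg_expr _ (fun x => x^-1)).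
  by apply: cvgV; [rewrite gt_eqF|exact: cvg_id].
Qed.

Lemma log_series_le (R : realType) (x : R) k : 0 < x < 1 ->
  \sum_(i < k) x ^+ i.+1 / i.+1%:R <= - ln (1 - x).
Proof.
move=> /andP[x0 x1].
have pos t : 0 <= t <= 1 -> 0 < 1 - x * t by move=> /andP[? ?]; nra.
(* What is left of x / (1 - x t) after k terms of its geometric expansion; its integral is the
   nonnegative remainder of the logarithmic series. *)
pose r k (t : R) := (x * t) ^+ k * x / (1 - x * t).
have cX k' : continuous (fun t : R => (0 + x * t) ^+ k').
  by move=> t; apply: (@cvg_expr _ (fun t => 0 + x * t)); exact: continuous_affine.
have intm k' : (@lebesgue_measure R).-integrable `[0, 1] (EFin \o (fun t => (0 + x * t) ^+ k' * x)).
  apply: continuous_integrable01 => t t01; apply: cvgM; last exact: cvg_cst.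
  exact: cX.
have intr k' : (@lebesgue_measure R).-integrable `[0, 1] (EFin \o r k').
  apply: continuous_integrable01 => t t01; apply: cvgM.
    apply: cvgM; last exact: cvg_cst.
    have := cX k' t; rewrite /continuous_at add0r.
    by under eq_fun do rewrite add0r.
  apply: cvgV; first by rewrite gt_eqF// pos.
  by apply: cvgB; [exact: cvg_cst|apply: cvgM; [exact: cvg_cst|exact: cvg_id]].
have -> : - ln (1 - x) = \sum_(i < k) x ^+ i.+1 / i.+1%:R +
    \int[lebesgue_measure]_(t in `[0, 1]) r k t.
  elim: k => [|k IH].
    have := @integral_inv_affine _ 1 (- x) ltr01; rewrite subr_gt0 => /(_ x1); rewrite ln1 subr0 => <-.
    rewrite big_ord0 add0r.
    rewrite -mulN1r -Rintegral01Z; last first.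
      apply: continuous_integrable01 => t t01; apply: cvgM; last exact: cvg_cst.
      by apply: cvgV; [rewrite mulNr gt_eqF// pos|exact: continuous_affine].
    apply: eq_Rintegral => t _; rewrite /r expr0 (mulNr x); ring.
  rewrite IH big_ord_recr/= -addrA; congr (_ + _).
  have := integral_expr_affine 0 x k; rewrite add0r expr0n/= subr0 => <-.
  rewrite -Rintegral01D//; apply: eq_Rintegral => t; rewrite inE/= in_itv/= => t01.
  by rewrite /r add0r exprS; field; rewrite gt_eqF// pos.
rewrite lerDl; apply: Rintegral_ge0 => t; rewrite /= in_itv/= => t01.
have /andP[t0 _] := t01; have x0' := ltW x0.
by rewrite /r !mulr_ge0 ?exprn_ge0 ?invr_ge0 ?mulr_ge0 // ltW// pos.
Qed.

(** * Growth of the weights *)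

Lemma power_diff_integrable (R : realType) (v : R -> R) k :
  (forall t, 0 < t < 1 -> {for t, continuous v}) ->
  (forall t, 0 < t < 1 -> 1 - t <= v t <= 1) ->
  (@lebesgue_measure R).-integrable `[0, 1]
    (EFin \o (fun t => ((1 - t) ^+ k - v t ^+ k) / t)).
Proof.
move=> cv bv; apply: (@bounded_integrable01 _ _ k%:R) => t t01; have /andP[t0 t1] := t01.
  apply: cvgM; last by apply: cvgV; [rewrite gt_eqF|exact: cvg_id].
  apply: cvgB; last by apply: cvg_expr; exact: cv.
  by apply: (@cvg_expr _ (fun t => 1 - t)); apply: cvgB; [exact: cvg_cst|exact: cvg_id].
have /andP[vl vr] := bv t t01.
have /(expr1B_bounds k)/andP[l _] : 0 <= t <= 1 by rewrite !ltW.
have t10 : 0 <= 1 - t by lra.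
have l2 : (1 - t) ^+ k <= v t ^+ k by rewrite lerXn2r// nnegrE//; lra.
have l3 : v t ^+ k <= 1 by rewrite exprn_ile1//; lra.
by rewrite normrM normfV (gtr0_norm t0) ler_pdivrMr// ler0_norm; lra.
Qed.

Lemma continuous1B (R : realType) : continuous (fun t : R => 1 - t).
Proof. by move=> t; apply: cvgB; [exact: cvg_cst|exact: cvg_id]. Qed.

Lemma continuous_affineB (R : realType) (b c : R) : continuous (fun t : R => b - c * t).
Proof.
move=> t; apply: cvgB; first exact: cvg_cst.
by apply: cvgM; [exact: cvg_cst|exact: cvg_id].
Qed.

Lemma continuous_inv1D (R : realType) (p t : R) : 0 < p -> 0 <= t ->
  {for t, continuous (fun t : R => (1 + p * t)^-1)}.
Proof.
move=> p0 t0; apply: cvgV; last exact: continuous_affine.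
by rewrite gt_eqF// ltr_pwDl// mulr_ge0// ltW.
Qed.

Lemma affine_between (R : realType) (p t : R) : 0 < p < 1 -> 0 < t < 1 ->
  1 - t <= 1 - (1 - p) * t <= 1.
Proof. by move=> /andP[? ?] /andP[? ?]; apply/andP; split; nra. Qed.

Lemma inv1D_between (R : realType) (p t : R) : 0 < p < 1 -> 0 < t < 1 ->
  1 - t <= (1 + p * t)^-1 <= 1.
Proof.
move=> /andP[p0 p1] /andP[t0 t1]; have q0 : 0 < 1 + p * t by nra.
apply/andP; split; last by rewrite invf_le1//; nra.
by rewrite -[_^-1]mul1r ler_pdivlMr//; nra.
Qed.

(** Passing from k to k + 1 cancels the division by t, so the integral is exactly minus the k-th
    partial sum of the series of - ln (1 - p). It measures the cost of replacing the base 1 - t of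
    Frullani's integrand by 1 - (1 - p) t. *)
Lemma power_gap1 (R : realType) (p : R) k : 0 < p < 1 ->
  ln (1 - p) <=
  \int[lebesgue_measure]_(t in `[0, 1]) (((1 - t) ^+ k - (1 - (1 - p) * t) ^+ k) / t).
Proof.
move=> p01; apply: (@le_trans _ _ (- \sum_(i < k) p ^+ i.+1 / i.+1%:R)).
  by rewrite lerNr; exact: log_series_le.
rewrite le_eqVlt; apply/orP; left; apply/eqP.
have intJ j : (@lebesgue_measure R).-integrable `[0, 1]
    (EFin \o (fun t => ((1 - t) ^+ j - (1 - (1 - p) * t) ^+ j) / t)).
  apply: power_diff_integrable => t t01; [exact: continuous_affineB|exact: affine_between].
elim: k => [|k IH].
  rewrite big_ord0 oppr0; under eq_Rintegral do rewrite !expr0 subrr mul0r.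
  by rewrite Rintegral_cst// mul0r.
have intA : (@lebesgue_measure R).-integrable `[0, 1] (EFin \o (fun t => (1 + -1 * t) ^+ k * -1)).
  apply: continuous_integrable01 => t t01; apply: cvgM; last exact: cvg_cst.
  by apply: (@cvg_expr _ (fun t => 1 + -1 * t)); exact: continuous_affine.
have intB : (@lebesgue_measure R).-integrable `[0, 1]
    (EFin \o (fun t => (1 + - (1 - p) * t) ^+ k * - (1 - p))).
  apply: continuous_integrable01 => t t01; apply: cvgM; last exact: cvg_cst.
  by apply: (@cvg_expr _ (fun t => 1 + - (1 - p) * t)); exact: continuous_affine.
transitivity (\int[lebesgue_measure]_(t in `[0, 1])
   ((((1 - t) ^+ k - (1 - (1 - p) * t) ^+ k) / t + (1 + -1 * t) ^+ k * -1) -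
    (1 + - (1 - p) * t) ^+ k * - (1 - p))).
  rewrite Rintegral01B//; last exact: integrable01D.
  rewrite Rintegral01D// -IH !integral_expr_affine big_ord_recr/=.
  have -> : 1 + - (1 - p) = p by ring.
  by rewrite subrr expr0n/= expr1n; ring.
apply: eq_Rintegral01 => //.
  by apply: integrable01B => //; exact: integrable01D.
move=> t /andP[t0 t1]; rewrite !exprS mulN1r (mulNr (1 - p)).
by field; rewrite gt_eqF.
Qed.

(** As for [power_gap1], the integral is computed exactly by induction. Two harmonic sums with
    shifted indices telescope and leave 1 / (k + 1); the rest is a partial sum of the series of - ln
    (1 - s) with s = 1 / (1 + p), where 1 - s = p s. *)
Lemma power_gap2 (R : realType) (p : R) k : 0 < p < 1 ->
  ln p - k.+1%:R^-1 <=
  \int[lebesgue_measure]_(t in `[0, 1]) (((1 - t) ^+ k.+1 - (1 + p * t)^-1 ^+ k.+1) / t).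
Proof.
move=> p01; have /andP[p0 p1] := p01.
have q0 : 0 < 1 + p by lra.
set s := (1 + p)^-1.
have s01 : 0 < s < 1 by rewrite invr_gt0 q0/= invf_lt1//; lra.
apply: (@le_trans _ _ (ln (1 + p) - k.+1%:R^-1 - \sum_(i < k) s ^+ i.+1 / i.+1%:R)).
  have := log_series_le k s01.
  have -> : 1 - s = p * s by rewrite /s; field; rewrite gt_eqF.
  rewrite lnM ?posrE//; last by have /andP[] := s01.
  have -> : ln s = - ln (1 + p) by rewrite lnV.
  have e (A B C D : R) : C <= - (A - B) -> A - D <= B - D - C by move=> ?; lra.
  exact: e.
rewrite le_eqVlt; apply/orP; left; apply/eqP.
have intJ j : (@lebesgue_measure R).-integrable `[0, 1]
    (EFin \o (fun t => ((1 - t) ^+ j - (1 + p * t)^-1 ^+ j) / t)).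
  apply: power_diff_integrable => t t01; last exact: inv1D_between.
  by apply: continuous_inv1D => //; have /andP[/ltW] := t01.
have intA j : (@lebesgue_measure R).-integrable `[0, 1] (EFin \o (fun t => (1 + -1 * t) ^+ j * -1)).
  apply: continuous_integrable01 => t t01; apply: cvgM; last exact: cvg_cst.
  by apply: (@cvg_expr _ (fun t => 1 + -1 * t)); exact: continuous_affine.
have intB j : (@lebesgue_measure R).-integrable `[0, 1]
    (EFin \o (fun t => (1 + p * t)^-1 ^+ j * p)).
  apply: continuous_integrable01 => t /andP[t0 _]; apply: cvgM; last exact: cvg_cst.
  by apply: (@cvg_expr _ (fun t => (1 + p * t)^-1)); exact: continuous_inv1D.
elim: k => [|k IH].
  rewrite big_ord0 subr0 invr1.
  transitivity (\int[lebesgue_measure]_(t in `[0, 1])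
     ((1 + -1 * t) ^+ 0 * -1 + (1 + p * t)^-1 ^+ 1 * p)).
    rewrite Rintegral01D// integral_expr_affine.
    under [X in _ = _ + X]eq_Rintegral do rewrite expr1.
    by rewrite integral_inv_affine// ln1 subr0 expr1 expr1n subrr sub0r divr1 addrC.
  apply: eq_Rintegral01 => //; first exact: integrable01D.
  move=> t /andP[t0 t1]; rewrite expr0 !expr1; field.
  by rewrite gt_eqF//= gt_eqF// addr_gt0// mulr_gt0.
transitivity (\int[lebesgue_measure]_(t in `[0, 1])
   ((((1 - t) ^+ k.+1 - (1 + p * t)^-1 ^+ k.+1) / t + (1 + -1 * t) ^+ k.+1 * -1) +
    (1 + p * t)^-1 ^+ k.+2 * p)).
  rewrite Rintegral01D//; last exact: integrable01D.
  rewrite Rintegral01D// -IH integral_expr_affine integral_invX_affine// big_ord_recr/=.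
  by rewrite subrr expr0n/= invr1 !expr1n -/s; ring.
apply: eq_Rintegral01 => //.
  by apply: integrable01D => //; exact: integrable01D.
move=> t /andP[t0 t1]; rewrite mulN1r 2!exprS [_^-1 ^+ k.+2]exprS.
have q1 : 0 < 1 + p * t by rewrite addr_gt0// mulr_gt0.
rewrite !exprS; set z := _^-1 ^+ k; set w := (1 - t) ^+ k.
by field; rewrite !gt_eqF.
Qed.

(** The increment has integrand (1 - p) (1 - A) / (- ln (1 - t)) with A = (1 - t)^k / (1 - p t)^(k +
    2), a perturbed Frullani integrand. A is compared with (1 - (1 - p) t)^k, whose distance from (1
    - t)^k is controlled by [power_gap1]. *)
Lemma Lambda1_step (R : realType) (p : R) k : 0 < p < 1 ->
  (1 - p) * (ln k.+1%:R + ln (1 - p)) - 2 / (1 - p) ^+ 2 / k.+1%:R <=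
  Lambda1 p k.+2 - Lambda1 p k.+1.
Proof.
move=> p01; have /andP[p0 p1] := p01; set a := 1 - p; have a0 : 0 < a by rewrite /a; lra.
have intF : (@lebesgue_measure R).-integrable `[0, 1]
    (EFin \o (fun t => (1 - (1 - t) ^+ k) / - ln (1 - t))).
  apply: (@frullani_integrable _ k%:R) => t t01.
    by apply: (@cvg_expr _ (fun t => 1 - t)); exact: continuous1B.
  have /andP[t0 t1] := t01.
  have /(expr1B_bounds k)/andP[l _] : 0 <= t <= 1 by rewrite !ltW.
  have h : (1 - t) ^+ k <= 1 by rewrite exprn_ile1//; lra.
  by rewrite ger0_norm ?subr_ge0//; lra.
have intJ : (@lebesgue_measure R).-integrable `[0, 1]
    (EFin \o (fun t => ((1 - t) ^+ k - (1 - a * t) ^+ k) / t)).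
  apply: power_diff_integrable => t t01; [exact: continuous_affineB|exact: affine_between].
have intB : (@lebesgue_measure R).-integrable `[0, 1]
    (EFin \o (fun t => (1 + - a * t) ^+ k * - a)).
  apply: continuous_integrable01 => t t01; apply: cvgM; last exact: cvg_cst.
  by apply: (@cvg_expr _ (fun t => 1 + - a * t)); exact: continuous_affine.
rewrite -Rintegral01B; [|exact: Lambda1_integrable|exact: Lambda1_integrable].
(* The last term pays for the two extra factors 1 / (1 - p t) in A, by 1 / (1 - p t)^2 <= 1 + (2 /
   a^2) t; its integral is O(1 / k). *)
apply: (@le_trans _ _ (\int[lebesgue_measure]_(t in `[0, 1])
    (a * ((1 - (1 - t) ^+ k) / - ln (1 - t) + ((1 - t) ^+ k - (1 - a * t) ^+ k) / t)
     + (2 / a ^+ 2) * ((1 + - a * t) ^+ k * - a)))).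
  rewrite Rintegral01D; [|by apply: integrable01Z; exact: integrable01D|exact: integrable01Z].
  rewrite !Rintegral01Z//; last exact: integrable01D.
  rewrite Rintegral01D// frullani_nat integral_expr_affine.
  have -> : 1 + - a = p by rewrite /a; ring.
  apply: lerD.
    by apply: ler_wpM2l; [exact: ltW|rewrite lerD2l; exact: power_gap1].
  rewrite expr1n -mulrN -[in leLHS]mulN1r; apply: ler_wpM2l.
    by rewrite divr_ge0// exprn_ge0// ltW.
  by apply: ler_wpM2r; rewrite ?invr_ge0// lerDr exprn_ge0// ltW.
apply: ge_Rintegral01.
- by apply: integrable01D; [apply: integrable01Z; exact: integrable01D|exact: integrable01Z].
- by apply: integrable01B; exact: Lambda1_integrable.
move=> t t01; have /andP[t0 t1] := t01; have D0 := oppln1B_gt0 t01; have Dt := ln1B_ge t1.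
have b0 : 0 < 1 - p * t by nra.
set D := - ln (1 - t) in D0 Dt *.
have lE : ln (1 - t) = - D by rewrite opprK.
set v := 1 - a * t; have v0 : 0 < v by rewrite /v /a; nra.
set A := (1 - t) ^+ k / (1 - p * t) ^+ k.+2.
have NE : Lambda1_num p k.+2 t / (t * ln (1 - t)) - Lambda1_num p k.+1 t / (t * ln (1 - t)) =
    a * ((1 - A) / D).
  rewrite lE /Lambda1_num /A !exprMn !exprVn !exprS -!natr1.
  have z0 : (1 - p * t) ^+ k != 0 by rewrite expf_neq0// gt_eqF.
  move: ((1 - p * t) ^+ k) z0 ((1 - t) ^+ k) (k%:R : R) => z z0 w x.
  by rewrite /a; field; rewrite z0 !gt_eqF//= subr_gt0.
rewrite [leRHS]NE.
have -> : (1 + - a * t) = v by rewrite mulNr.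
have -> : a * ((1 - (1 - t) ^+ k) / D + ((1 - t) ^+ k - v ^+ k) / t) + 2 / a ^+ 2 * (v ^+ k * - a) =
   a * ((1 - (1 - t) ^+ k) / D + ((1 - t) ^+ k - v ^+ k) / t - 2 / a ^+ 2 * v ^+ k) by ring.
apply: ler_wpM2l; first exact: ltW.
have tv : (1 - t) ^+ k <= v ^+ k.
  have /andP[tv _] := affine_between p01 t01.
  by apply: lerXn2r => //; rewrite nnegrE ?(ltW v0)//; lra.
have Ab : A <= v ^+ k * (1 + 2 / a ^+ 2 * t).
  have -> : A = ((1 - t) / (1 - p * t)) ^+ k * (1 - p * t) ^- 2.
    rewrite /A expr_div_n -addn2 exprD; field.
    by rewrite expf_neq0 gt_eqF.
  have sv : (1 - t) / (1 - p * t) <= v by rewrite ler_pdivrMr// /v /a; nra.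
  apply: ler_pM.
  - by rewrite exprn_ge0// divr_ge0// ltW// subr_gt0.
  - by rewrite invr_ge0 exprn_ge0// ltW.
  - have sv0 : 0 <= (1 - t) / (1 - p * t) by apply: divr_ge0; [rewrite subr_ge0 ltW|exact: ltW].
    by apply: lerXn2r => //; rewrite nnegrE; exact: ltW.
  rewrite -[leLHS]mul1r ler_pdivrMr ?exprn_gt0//.
  have ab : a ^+ 2 <= (1 - p * t) ^+ 2 by rewrite !expr2 ler_pM ?ltW// /a; nra.
  have -> : (1 + 2 / a ^+ 2 * t) * (1 - p * t) ^+ 2 =
    (1 - p * t) ^+ 2 + 2 * t * ((1 - p * t) ^+ 2 / a ^+ 2) by field; rewrite gt_eqF.
  have : 1 <= (1 - p * t) ^+ 2 / a ^+ 2 by rewrite ler_pdivlMr ?mul1r ?exprn_gt0.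
  have := ltW t0; nra.
have vk0 : 0 <= v ^+ k by rewrite exprn_ge0// ltW.
have a20 : 0 <= 2 / a ^+ 2 by rewrite divr_ge0// exprn_ge0// ltW.
(* The numerator is nonpositive, so replacing D by the smaller t lowers the quotient. *)
have h1 : ((1 - t) ^+ k - v ^+ k) / t <= ((1 - t) ^+ k - v ^+ k) / D.
  by rewrite ler_wnM2l ?subr_le0// lef_pV2.
have h2 : v ^+ k * (2 / a ^+ 2) * t / D <= v ^+ k * (2 / a ^+ 2).
  by rewrite ler_pdivrMr// ler_wpM2l// mulr_ge0.
apply: (@le_trans _ _ ((1 - (1 - t) ^+ k) / D + ((1 - t) ^+ k - v ^+ k) / D -
   v ^+ k * (2 / a ^+ 2) * t / D)); first by rewrite (mulrC (2 / _)) lerB// lerD2l.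
have -> : (1 - (1 - t) ^+ k) / D + ((1 - t) ^+ k - v ^+ k) / D - v ^+ k * (2 / a ^+ 2) * t / D =
   (1 - v ^+ k * (1 + 2 / a ^+ 2 * t)) / D by ring.
by rewrite ler_pM2r ?invr_gt0// lerD2l lerN2.
Qed.

(** With s = 1 / (1 + p t) one has 1 - s = p t s, so the increment has integrand p (1 - s^(k + 2)) /
    (- ln (1 - t)): Frullani's, with s in place of 1 - t. *)
Lemma Lambda2_step (R : realType) (p : R) k : 0 < p < 1 ->
  p * (ln k.+1%:R + ln p) - k.+1%:R^-1 <= Lambda2 p k.+2 - Lambda2 p k.+1.
Proof.
move=> p01; have /andP[p0 p1] := p01.
have intF : (@lebesgue_measure R).-integrable `[0, 1]
    (EFin \o (fun t => (1 - (1 - t) ^+ k.+2) / - ln (1 - t))).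
  apply: (@frullani_integrable _ k.+2%:R) => t t01.
    by apply: (@cvg_expr _ (fun t => 1 - t)); exact: continuous1B.
  have /andP[t0 t1] := t01.
  have /(expr1B_bounds k.+2)/andP[l _] : 0 <= t <= 1 by rewrite !ltW.
  have h : (1 - t) ^+ k.+2 <= 1 by rewrite exprn_ile1//; lra.
  by rewrite ger0_norm ?subr_ge0//; lra.
have intJ : (@lebesgue_measure R).-integrable `[0, 1]
    (EFin \o (fun t => ((1 - t) ^+ k.+2 - (1 + p * t)^-1 ^+ k.+2) / t)).
  apply: power_diff_integrable => t t01; last exact: inv1D_between.
  by apply: continuous_inv1D => //; have /andP[/ltW] := t01.
rewrite -Rintegral01B; [|exact: Lambda2_integrable|exact: Lambda2_integrable].
apply: (@le_trans _ _ (\int[lebesgue_measure]_(t in `[0, 1])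
    (p * ((1 - (1 - t) ^+ k.+2) / - ln (1 - t) + ((1 - t) ^+ k.+2 - (1 + p * t)^-1 ^+ k.+2) / t)))).
  rewrite Rintegral01Z; last exact: integrable01D.
  rewrite Rintegral01D// frullani_nat.
  have h1 := @power_gap2 _ p k.+1 p01.
  have h2 : ln k.+1%:R <= ln k.+3%:R :> R by rewrite ler_ln ?posrE ?ltr0n// ler_nat -addn2 leq_addr.
  have h3 : k.+2%:R^-1 <= k.+1%:R^-1 :> R by rewrite lef_pV2 ?posrE ?ltr0n// ler_nat.
  have h4 : p * k.+1%:R^-1 <= k.+1%:R^-1 :> R by rewrite ler_piMl ?invr_ge0// ltW.
  move: h1 h2 h3 h4; set J := Rintegral _ _ _; move: (ln _) (ln _) (ln _) (_^-1) (_^-1) => a b c d e.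
  move=> h1 h2 h3 h4.
  have h5 := ler_wpM2l (ltW p0) h3.
  apply: (@le_trans _ _ (p * (b + c - e))); first by nra.
  by apply: ler_wpM2l; [exact: ltW|lra].
apply: ge_Rintegral01.
- by apply: integrable01Z; exact: integrable01D.
- by apply: integrable01B; exact: Lambda2_integrable.
move=> t t01; have /andP[t0 t1] := t01; have D0 := oppln1B_gt0 t01; have Dt := ln1B_ge t1.
have q0 : 0 < 1 + p * t by nra.
set D := - ln (1 - t) in D0 Dt *.
have lE : ln (1 - t) = - D by rewrite opprK.
set s := (1 + p * t)^-1; have /andP[ts s1] : 1 - t <= s <= 1 by exact: inv1D_between.
have NE : Lambda2_num p k.+2 t / (t * ln (1 - t)) - Lambda2_num p k.+1 t / (t * ln (1 - t)) =
    p * ((1 - s ^+ k.+2) / D).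
  rewrite lE /Lambda2_num /s !exprMn !expr1n !exprVn !exprS -!natr1.
  have z0 : (1 + p * t) ^+ k != 0 by rewrite expf_neq0// gt_eqF.
  move: ((1 + p * t) ^+ k) z0 (k%:R : R) => z z0 x.
  by field; rewrite z0 !gt_eqF.
rewrite [leRHS]NE; apply: ler_wpM2l; first exact: ltW.
have tv : (1 - t) ^+ k.+2 <= s ^+ k.+2.
  by rewrite lerXn2r ?nnegrE//; lra.
have h1 : ((1 - t) ^+ k.+2 - s ^+ k.+2) / t <= ((1 - t) ^+ k.+2 - s ^+ k.+2) / D.
  by rewrite ler_wnM2l ?subr_le0// lef_pV2.
apply: (@le_trans _ _ ((1 - (1 - t) ^+ k.+2) / D + ((1 - t) ^+ k.+2 - s ^+ k.+2) / D)).
  by rewrite lerD2l.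
by rewrite -mulrDl ler_pM2r ?invr_gt0//; lra.
Qed.

Definition log_weight (R : realType) (p : R) (y : nat) : R :=
  ln (y.-1)`!%:R - Lambda1 p y - Lambda2 p y - y%:R * binary_entropy p.

(** The increment ln (k + 1) of ln k! is consumed by (1 - p) ln (k + 1) from [Lambda1] and p ln (k +
    1) from [Lambda2], and the constants ln (1 - p) and ln p there cancel the entropy; only O(1 / k)
    survives. *)
Lemma log_weight_step (R : realType) (p : R) k : 0 < p < 1 ->
  log_weight p k.+2 - log_weight p k.+1 <= (2 / (1 - p) ^+ 2 + 1) / k.+1%:R.
Proof.
move=> p01; have := Lambda1_step k p01; have := Lambda2_step k p01.
rewrite /log_weight /binary_entropy /= factS natrM lnM ?posrE ?ltr0n ?fact_gt0// -[k.+2%:R]natr1.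
have e (a b c d x y l lp la lf n : R) :
    p * (l + lp) - y <= c - d -> (1 - p) * (l + la) - x * y <= a - b ->
    l + lf - a - c - (n + 1) * (- p * lp - (1 - p) * la) -
      (lf - b - d - n * (- p * lp - (1 - p) * la)) <= (x + 1) * y.
  have -> : l + lf - a - c - (n + 1) * (- p * lp - (1 - p) * la) -
      (lf - b - d - n * (- p * lp - (1 - p) * la)) =
      p * (l + lp) + (1 - p) * (l + la) - (a - b) - (c - d) by ring.
  have -> : (x + 1) * y = x * y + y by ring.
  by move: (p * _) ((1 - p) * _) (x * y) => u v z; lra.
by move=> h1 h2; exact: e.
Qed.

(** * The negative binomial law *)

(** Law of the excess Y - b of the output length of a run over its input length b. At b = 0 the
    truncated predecessor still yields the point mass at 0, where inductions on b start. *)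
Definition nbinom (R : realType) (p : R) (b j : nat) : R :=
  'C((b + j).-1, j)%:R * (1 - p) ^+ b * p ^+ j.

Lemma nbinom_ge0 (R : realType) (p : R) b j : 0 < p < 1 -> 0 <= nbinom p b j.
Proof.
move=> /andP[p0 p1]; rewrite /nbinom !mulr_ge0// exprn_ge0//; first by rewrite subr_ge0 ltW.
exact: ltW.
Qed.

Lemma nbinom_gt0 (R : realType) (p : R) b j : 0 < p < 1 -> 0 < nbinom p b.+1 j.
Proof.
move=> /andP[p0 p1]; rewrite /nbinom !mulr_gt0 ?exprn_gt0 ?subr_gt0// ltr0n bin_gt0.
by rewrite addSn /= leq_addl.
Qed.

Lemma nbinom0 (R : realType) (p : R) j : nbinom p 0 j = (j == 0%N)%:R.
Proof.
rewrite /nbinom add0n expr0 mulr1; case: j => [|j]; first by rewrite bin0 expr0 mulr1.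
by rewrite bin_small// mul0r.
Qed.

Lemma nbinomSS (R : realType) (p : R) b j :
  nbinom p b.+1 j.+1 = p * nbinom p b.+1 j + (1 - p) * nbinom p b j.+1.
Proof.
rewrite /nbinom !addSn !addnS /= binS natrD !exprS; ring.
Qed.

(** Unrolls Pascal's rule [nbinomSS]; the sum is the convolution with the excess of one geometric
    variable. *)
Lemma nbinom_convolution (R : realType) (p : R) b j :
  nbinom p b.+1 j = \sum_(i < j.+1) (1 - p) * p ^+ i * nbinom p b (j - i).
Proof.
elim: j => [|j IH].
  by rewrite big_ord1 /nbinom !addn0 !bin0 !expr0 exprS; ring.
rewrite nbinomSS IH [in RHS]big_ord_recl/= subn0 expr0 mulr1 addrC; congr (_ + _).
rewrite mulr_sumr; apply: eq_bigr => i _; rewrite subSS /bump/= exprS; ring.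
Qed.

(** Size biasing: weighting by the length raises b by one, so the first moment, and a bound on the
    second, follow from normalization alone. *)
Lemma nbinom_mean_id (R : realType) (p : R) b j : 0 < p < 1 ->
  nbinom p b j * (b + j)%:R = b%:R / (1 - p) * nbinom p b.+1 j.
Proof.
move=> /andP[p0 p1]; rewrite /nbinom exprS.
have E : 'C((b + j).-1, j)%:R * (b + j)%:R = b%:R * 'C((b + j), j)%:R :> R.
  rewrite -!natrM; congr (_%:R); case: b => [|b].
    by rewrite add0n; case: j => [|j]//; rewrite bin_small.
  by rewrite mulnC mul_bin_down addnK.
have e (x y z w : R) : x * y * z * w = x * w * y * z by ring.
rewrite addSn /= e E; field.
by rewrite gt_eqF// subr_gt0.
Qed.

(** Exponential tilting: the generating function follows from normalization at the parameter p s. *)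
Lemma nbinom_tilt (R : realType) (p s : R) b j : 0 < p < 1 -> 0 <= s -> p * s < 1 ->
  nbinom p b j * s ^+ j = ((1 - p) / (1 - p * s)) ^+ b * nbinom (p * s) b j.
Proof.
move=> /andP[p0 p1] s0 ps1; rewrite /nbinom expr_div_n exprMn; field.
by rewrite expf_neq0// gt_eqF// subr_gt0.
Qed.

Lemma cvg_series_of_eseries (R : realType) (u : nat -> R) (l : R) :
  (forall i, 0 <= u i) -> (\sum_(i <oo) (u i)%:E = l%:E)%E -> series u @ \oo --> l.
Proof.
move=> u0 ul.
have : (fun n => (\sum_(0 <= i < n) (u i)%:E)%E) @ \oo --> l%:E.
  rewrite -ul; apply: is_cvg_nneseries => i _ _; by rewrite lee_fin.
by under eq_fun do rewrite sumEFin; move/fine_cvgP => [].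
Qed.

Lemma eseries_of_cvg_series (R : realType) (u : nat -> R) (l : R) :
  series u @ \oo --> l -> (\sum_(i <oo) (u i)%:E = l%:E)%E.
Proof.
move=> ul; apply/cvg_lim => //.
under eq_fun do rewrite sumEFin.
by apply: cvg_EFin => //; exact: nearW.
Qed.

(** Stated for extended nonnegative F so that sums can be exchanged without summability. F = 1 gives
    normalization; a bounded F serves to merge adjacent runs of the same bit. *)
Lemma eseries_nbinomS (R : realType) (p : R) b (F : nat -> \bar R) : 0 < p < 1 ->
  (forall j, 0 <= F j)%E ->
  (\sum_(j <oo) (nbinom p b.+1 j)%:E * F j =
   \sum_(i <oo) ((1 - p) * p ^+ i)%:E * \sum_(j <oo) (nbinom p b j)%:E * F (i + j)%N)%E.
Proof.
move=> p01 F0; have /andP[p0 p1] := p01.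
have c0 i : 0 <= (1 - p) * p ^+ i by rewrite mulr_ge0 ?exprn_ge0 ?subr_ge0// ltW.
(* Extending the triangle i <= z by 0 turns the inner finite sums into full series, whose order can
   be swapped. *)
pose a i z : \bar R := (if (i <= z)%N then ((1 - p) * p ^+ i)%:E * ((nbinom p b (z - i))%:E * F z) else 0)%E.
have a0 i z : (0 <= a i z)%E.
  by rewrite /a; case: ifP => // _; rewrite !mule_ge0// lee_fin ?nbinom_ge0.
transitivity (\sum_(z <oo) \sum_(i <oo) a i z)%E.
  apply: eq_eseriesr => z _.
  rewrite (@nneseries_split _ _ 0 z.+1); last by move=> i _; exact: a0.
  rewrite add0n [X in (_ + X)%E]eseries0 ?adde0; last first.
    by move=> i zi _; rewrite /a leqNgt zi.
  rewrite big_mkord nbinom_convolution -sumEFin ge0_sume_distrl; last first.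
    by move=> i _; rewrite lee_fin mulr_ge0// nbinom_ge0.
  by apply: eq_bigr => i _; rewrite /a -ltnS ltn_ord EFinM muleA.
rewrite nneseries_interchange//; apply: eq_eseriesr => i _.
rewrite (@nneseries_split _ _ 0 i); last by move=> k _; exact: a0.
rewrite add0n big1_seq ?add0e; last first.
  by move=> z; rewrite mem_index_iota => /andP[_ /andP[_ zi]]; rewrite /a leqNgt zi.
rewrite -nneseriesZl; last by move=> j _; rewrite mule_ge0// lee_fin nbinom_ge0.
rewrite -nneseries_addn; last by move=> k; exact: a0.
by apply: eq_eseriesr => j _; rewrite /a leq_addl addnK addnC.
Qed.

Lemma series_nbinom (R : realType) (p : R) b : 0 < p < 1 ->
  series (nbinom p b) @ \oo --> (1 : R).
Proof.
move=> p01; have /andP[p0 p1] := p01.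
apply: cvg_series_of_eseries; first by move=> j; exact: nbinom_ge0.
elim: b => [|b IH].
  rewrite (@nneseries_split _ _ 0 1); last by move=> j _; rewrite lee_fin nbinom_ge0.
  rewrite add0n big_nat1 nbinom0 eqxx eseries0 ?adde0// => i i0 _.
  by rewrite nbinom0 gtn_eqF.
have := @eseries_nbinomS R p b (fun=> 1%E) p01 (fun=> lee01).
under eq_eseriesr do rewrite mule1.
move=> ->.
under eq_eseriesr do under eq_eseriesr do rewrite mule1.
under eq_eseriesr do rewrite IH mule1.
apply: eseries_of_cvg_series.
have := @cvg_geometric_series _ (1 - p) p; rewrite ger0_norm ?ltW// => /(_ p1).
by rewrite divff// gt_eqF// subr_gt0.
Qed.

Lemma cvg_seriesZ (R : realType) (c l : R) (u : nat -> R) : series u @ \oo --> l ->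
  series (fun j => c * u j) @ \oo --> c * l.
Proof.
move=> ul; have -> : series (fun j => c * u j) = (fun n => c * series u n).
  by apply/funext => n; rewrite /series/= mulr_sumr.
by apply: cvgM => //; exact: cvg_cst.
Qed.

Lemma cvg_seriesD (R : realType) (l m : R) (u v : nat -> R) : series u @ \oo --> l ->
  series v @ \oo --> m -> series (fun j => u j + v j) @ \oo --> l + m.
Proof.
move=> ul vm; have -> : series (fun j => u j + v j) = (fun n => series u n + series v n).
  by apply/funext => n; rewrite /series/= big_split.
exact: cvgD.
Qed.

Lemma series_nbinom_mean (R : realType) (p : R) b : 0 < p < 1 ->
  series (fun j => nbinom p b j * (b + j)%:R) @ \oo --> b%:R / (1 - p).
Proof.
move=> p01; under eq_fun do rewrite nbinom_mean_id//.
by have := cvg_seriesZ (c := b%:R / (1 - p)) (series_nbinom b.+1 p01); rewrite mulr1.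
Qed.

Lemma series_nbinom_moment2 (R : realType) (p : R) b : 0 < p < 1 ->
  cvgn (series (fun j => nbinom p b j * (b + j)%:R ^+ 2)).
Proof.
move=> p01; have /andP[p0 p1] := p01.
apply: (@series_le_cvg _ _ (fun j => (b%:R / (1 - p) * (b.+1%:R / (1 - p))) * nbinom p b.+2 j)).
- by move=> j; rewrite mulr_ge0 ?nbinom_ge0// exprn_ge0.
- by move=> j; rewrite mulr_ge0 ?nbinom_ge0// mulr_ge0// divr_ge0// subr_ge0 ltW.
- move=> j.
  have -> : b%:R / (1 - p) * (b.+1%:R / (1 - p)) * nbinom p b.+2 j =
      nbinom p b j * (b + j)%:R * (b.+1 + j)%:R.
    by rewrite nbinom_mean_id// -[RHS]mulrA (nbinom_mean_id b.+1)// [RHS]mulrA.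
  rewrite expr2 mulrA; apply: ler_wpM2l; first by apply: mulr_ge0; [exact: nbinom_ge0|].
  by rewrite ler_nat addSn leqnSn.
- by apply/cvg_ex; eexists; apply: cvg_seriesZ; exact: series_nbinom.
Qed.

Lemma series_nbinom_pgf (R : realType) (p s : R) b : 0 < p < 1 -> 0 < s -> p * s < 1 ->
  series (fun j => nbinom p b j * s ^+ j) @ \oo --> ((1 - p) / (1 - p * s)) ^+ b.
Proof.
move=> p01 s0 ps1; have /andP[p0 p1] := p01.
under eq_fun do rewrite nbinom_tilt// ?ltW//.
have ps01 : 0 < p * s < 1 by rewrite mulr_gt0.
by have := cvg_seriesZ (c := ((1 - p) / (1 - p * s)) ^+ b) (series_nbinom b ps01); rewrite mulr1.
Qed.

(** * Divergence from the reference weights *)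

Lemma integrable01_sum (R : realType) (c : nat -> R) (f : nat -> R -> R) n :
  (forall j, (@lebesgue_measure R).-integrable `[0, 1] (EFin \o f j)) ->
  (@lebesgue_measure R).-integrable `[0, 1] (EFin \o (fun t => \sum_(0 <= j < n) c j * f j t)).
Proof.
move=> fi; elim: n => [|n IH].
  have -> : (fun t => \sum_(0 <= j < 0) c j * f j t) = cst 0.
    by apply/funext => t; rewrite big_nil.
  by apply: continuous_integrable01 => t _; exact: cvg_cst.
have -> : (fun t => \sum_(0 <= j < n.+1) c j * f j t) =
    (fun t => \sum_(0 <= j < n) c j * f j t + c n * f n t).
  by apply/funext => t; rewrite big_nat_recr.
by apply: integrable01D => //; exact: integrable01Z.
Qed.

Lemma Rintegral01_sum (R : realType) (c : nat -> R) (f : nat -> R -> R) n :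
  (forall j, (@lebesgue_measure R).-integrable `[0, 1] (EFin \o f j)) ->
  \int[lebesgue_measure]_(t in `[0, 1]) (\sum_(0 <= j < n) c j * f j t) =
  \sum_(0 <= j < n) c j * \int[lebesgue_measure]_(t in `[0, 1]) f j t.
Proof.
move=> fi; elim: n => [|n IH].
  under eq_Rintegral do rewrite big_nil.
  by rewrite Rintegral_cst// mul0r big_nil.
under eq_Rintegral do rewrite big_nat_recr//=.
rewrite Rintegral01D; [|exact: integrable01_sum|exact: integrable01Z].
by rewrite IH Rintegral01Z// [in RHS]big_nat_recr.
Qed.

(* Dominated convergence, the partial sums being dominated by the second moment of the weights. *)
Lemma series_Rintegral01 (R : realType) (p C : R) b (f : nat -> R -> R) (l : R -> R) :
  0 < p < 1 ->
  (forall j, (@lebesgue_measure R).-integrable `[0, 1] (EFin \o f j)) ->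
  (@lebesgue_measure R).-integrable `[0, 1] (EFin \o l) ->
  (forall j t, 0 < t < 1 -> `|f j t| <= C * (b + j)%:R ^+ 2) ->
  (forall t, 0 < t < 1 -> series (fun j => nbinom p b j * f j t) @ \oo --> l t) ->
  series (fun j => nbinom p b j * \int[lebesgue_measure]_(t in `[0, 1]) f j t) @ \oo -->
  \int[lebesgue_measure]_(t in `[0, 1]) l t.
Proof.
move=> p01 fi li fb fl.
have oo (h : R -> R) : (@lebesgue_measure R).-integrable `[0, 1] (EFin \o h) ->
    (\int[lebesgue_measure]_(t in `[0%R, 1%R]) (h t)%:E = \int[lebesgue_measure]_(t in `]0%R, 1%R[) (h t)%:E)%E.
  move=> /integrableP[mh _]; rewrite integral_itv_bndoo//.
  by apply: measurable_funS mh => //; exact: subset_itv_oo_cc.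
have mo (h : R -> R) : (@lebesgue_measure R).-integrable `[0, 1] (EFin \o h) ->
    measurable_fun (`]0, 1[ : set R) (EFin \o h).
  move=> /integrableP[mh _].
  by apply: measurable_funS mh => //; exact: subset_itv_oo_cc.
pose M := limn (series (fun j => nbinom p b j * (b + j)%:R ^+ 2)).
have S2 := @series_nbinom_moment2 _ p b p01.
have w0 j : 0 <= nbinom p b j by exact: nbinom_ge0.
have u0 j : 0 <= nbinom p b j * (b + j)%:R ^+ 2 by rewrite mulr_ge0// exprn_ge0.
have Mb n : series (fun j => nbinom p b j * (b + j)%:R ^+ 2) n <= M.
  by apply: nondecreasing_cvgn_le => //; apply: nondecreasing_series => j _.
pose F n (t : R) := \sum_(0 <= j < n) nbinom p b j * f j t.
have Fi n : (@lebesgue_measure R).-integrable `[0, 1] (EFin \o F n) by exact: integrable01_sum.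
have [] := @dominated_convergence _ _ _ (@lebesgue_measure R) (`]0%R, 1%R[ : set R)
  (measurable_itv _) (fun n => EFin \o F n) (EFin \o l) (EFin \o cst (C * M)).
- by move=> n; exact: mo.
- exact: mo.
- apply: aeW => t /=; rewrite in_itv/= => t01.
  by apply: cvg_EFin; [exact: nearW|exact: fl].
- have ci : (@lebesgue_measure R).-integrable `[0, 1] (EFin \o cst (C * M)).
    by apply: continuous_integrable01 => t _; exact: cvg_cst.
  by apply: integrableS ci => //; exact: subset_itv_oo_cc.
- apply: aeW => t n /=; rewrite in_itv/= => t01; rewrite lee_fin.
  apply: (le_trans (ler_norm_sum _ _ _)).
  have C0 : 0 <= C.
    (* The index 1 makes (b + 1)^2 positive even when b = 0. *)
    have := fb 1%N t t01 => /(le_trans (normr_ge0 _)); rewrite pmulr_lge0//.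
  apply: (@le_trans _ _ (C * series (fun j => nbinom p b j * (b + j)%:R ^+ 2) n)).
    rewrite /series/= mulr_sumr; apply: ler_sum => j _.
    by rewrite normrM ger0_norm// mulrCA ler_wpM2l// fb.
  by rewrite ler_wpM2l.
move=> _ _ H.
have {}H : (fun n => \int[lebesgue_measure]_(t in `[0%R, 1%R]) (F n t)%:E)%E @ \oo -->
    (\int[lebesgue_measure]_(t in `[0%R, 1%R]) (l t)%:E)%E.
  rewrite oo//.
  have -> : (fun n => \int[lebesgue_measure]_(t in `[0%R, 1%R]) (F n t)%:E)%E =
    (fun n => \int[lebesgue_measure]_(t in `]0%R, 1%R[) (F n t)%:E)%E.
    by apply/funext => n; rewrite oo.
  exact: H.
have -> : series (fun j => nbinom p b j * \int[lebesgue_measure]_(t in `[0, 1]) f j t) =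
    (fun n => fine (\int[lebesgue_measure]_(t in `[0%R, 1%R]) (F n t)%:E)%E).
  by apply/funext => n; rewrite -[RHS]/(Rintegral _ _ _) Rintegral01_sum.
apply: fine_cvg; rewrite fineK//.
by apply: integrable_fin_num.
Qed.

Lemma series_Lambda1 (R : realType) (p : R) b : 0 < p < 1 ->
  series (fun j => nbinom p b.+1 j * Lambda1 p (b.+1 + j)) @ \oo --> (ln b`!%:R : R).
Proof.
move=> p01; have /andP[p0 p1] := p01; rewrite -gamma_integral.
apply: (@series_Rintegral01 _ p ((1 - p) ^- 3) b.+1
   (fun j t => Lambda1_num p (b + j).+1 t / (t * ln (1 - t)))) => //.
- by move=> j; exact: Lambda1_integrable.
- exact: gamma_integrable.
- by move=> j t t01; apply: quotient_bound => //; exact: Lambda1_num_bound.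
move=> t t01; have /andP[t0 t1] := t01.
have q0 : 0 < 1 - p * t by nra.
(* The solution of (1 - p) s / (1 - p s) = 1 - t: the generating function of Y there is (1 - t)^(b +
   1), and the division by 1 - t in [Lambda1_num] leaves the power in [gamma_num b]. *)
set s := (1 - t) / (1 - p * t).
have s0 : 0 < s by rewrite divr_gt0// subr_gt0.
have psE : 1 - p * s = (1 - p) / (1 - p * t) by rewrite /s; field; rewrite gt_eqF.
have ps1 : p * s < 1 by rewrite -subr_gt0 psE divr_gt0// subr_gt0.
have -> : (fun j => nbinom p b.+1 j * (Lambda1_num p (b + j).+1 t / (t * ln (1 - t)))) =
   (fun j => (t * ln (1 - t))^-1 * ((1 + t) * nbinom p b.+1 j +
      ((- t * (1 - p)) * (nbinom p b.+1 j * (b.+1 + j)%:R) +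
       (- (s ^+ b.+1 / (1 - t))) * (nbinom p b.+1 j * s ^+ j)))).
  by apply/funext => j; rewrite /Lambda1_num -/s -addSn exprD; ring.
have -> : gamma_num b t / (t * ln (1 - t)) =
   (t * ln (1 - t))^-1 * ((1 + t) * 1 +
      ((- t * (1 - p)) * (b.+1%:R / (1 - p)) +
       (- (s ^+ b.+1 / (1 - t))) * ((1 - p) / (1 - p * s)) ^+ b.+1)).
  rewrite mulrC; congr (_ * _); rewrite /gamma_num psE.
  have -> : (1 - p) / ((1 - p) / (1 - p * t)) = 1 - p * t by field; rewrite !gt_eqF// subr_gt0.
  have -> : s ^+ b.+1 / (1 - t) = (1 - t) ^+ b / (1 - p * t) ^+ b.+1.
    by rewrite /s expr_div_n exprS; field; rewrite expf_neq0 ?gt_eqF// subr_gt0.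
  rewrite -natr1; field; rewrite expf_neq0 ?gt_eqF// subr_gt0//.
apply: cvg_seriesZ; apply: cvg_seriesD; first by apply: cvg_seriesZ; exact: series_nbinom.
apply: cvg_seriesD; apply: cvg_seriesZ; first exact: series_nbinom_mean.
exact: series_nbinom_pgf.
Qed.

(** The mean of ln j! is not evaluated in closed form, so only the difference is summed. Its
    integrand has mean 0 for each t, because at s = 1 / (1 + p t) the mean of s^(b + j) equals that
    of (1 - t)^j. *)
Lemma series_Lambda2 (R : realType) (p : R) b : 0 < p < 1 ->
  series (fun j => nbinom p b j * (Lambda2 p (b + j) - ln j`!%:R)) @ \oo --> (0 : R).
Proof.
move=> p01; have /andP[p0 p1] := p01.
have -> : 0 = \int[lebesgue_measure]_(t in `[0, 1]) (cst 0 t) :> R.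
  by rewrite Rintegral_cst// mul0r.
have -> : (fun j => nbinom p b j * (Lambda2 p (b + j) - ln j`!%:R)) =
    (fun j => nbinom p b j * \int[lebesgue_measure]_(t in `[0, 1])
       (Lambda2_num p (b + j) t / (t * ln (1 - t)) - gamma_num j t / (t * ln (1 - t)))).
  apply/funext => j; rewrite -gamma_integral Rintegral01B//; last exact: gamma_integrable.
  exact: Lambda2_integrable.
apply: (@series_Rintegral01 _ p 3 b (fun j t => Lambda2_num p (b + j) t / (t * ln (1 - t)) -
   gamma_num j t / (t * ln (1 - t)))) => //.
- by move=> j; apply: integrable01B; [exact: Lambda2_integrable|exact: gamma_integrable].
- by apply: continuous_integrable01 => t _; exact: cvg_cst.
- move=> j t t01; apply: (le_trans (ler_normB _ _)).
  have h1 := quotient_bound t01 (Lambda2_num_bound (b + j) p01 t01).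
  have h2 := quotient_bound t01 (gamma_num_bound j t01).
  have h3 : j%:R ^+ 2 <= (b + j)%:R ^+ 2 :> R by rewrite lerXn2r ?nnegrE// ler_nat leq_addl.
  by apply: (le_trans (lerD h1 h2)); lra.
move=> t t01; have /andP[t0 t1] := t01.
have q0 : 0 < 1 + p * t by nra.
have r0 : 0 < 1 - p + p * t by nra.
set s := 1 / (1 + p * t).
have s0 : 0 < s by rewrite divr_gt0.
have psE : 1 - p * s = (1 - p + p * t) / (1 + p * t) by rewrite /s; field; rewrite gt_eqF.
have ps1 : p * s < 1 by rewrite -subr_gt0 psE divr_gt0.
have pt1 : p * (1 - t) < 1 by nra.
have t10 : 0 < 1 - t by lra.
have -> : (fun j => nbinom p b j * (Lambda2_num p (b + j) t / (t * ln (1 - t)) - gamma_num j t / (t * ln (1 - t)))) =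
   (fun j => (t * ln (1 - t))^-1 * ((- t * b%:R) * nbinom p b j +
      ((t * (1 - p)) * (nbinom p b j * (b + j)%:R) +
       ((- s ^+ b) * (nbinom p b j * s ^+ j) + 1 * (nbinom p b j * (1 - t) ^+ j))))).
  by apply/funext => j; rewrite /Lambda2_num /gamma_num -/s exprD natrD; ring.
have -> : cst 0 t =
   (t * ln (1 - t))^-1 * ((- t * b%:R) * 1 +
      ((t * (1 - p)) * (b%:R / (1 - p)) +
       ((- s ^+ b) * ((1 - p) / (1 - p * s)) ^+ b + 1 * ((1 - p) / (1 - p * (1 - t))) ^+ b))).
  have -> : 1 - p * (1 - t) = 1 - p + p * t by ring.
  rewrite !mulNr mul1r -exprMn psE.
  have -> : s * ((1 - p) / ((1 - p + p * t) / (1 + p * t))) = (1 - p) / (1 - p + p * t).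
    by rewrite /s; field; rewrite !gt_eqF.
  rewrite addNr addr0 (_ : - (t * b%:R * 1) + t * (1 - p) * (b%:R / (1 - p)) = 0) ?mulr0//.
  by field; rewrite gt_eqF// subr_gt0.
apply: cvg_seriesZ; apply: cvg_seriesD; first by apply: cvg_seriesZ; exact: series_nbinom.
apply: cvg_seriesD; first by apply: cvg_seriesZ; exact: series_nbinom_mean.
by apply: cvg_seriesD; apply: cvg_seriesZ; exact: series_nbinom_pgf.
Qed.

(** ln (b + j)! occurs in both logarithms and cancels. The linear terms cancel on average because
    the mean (b + 1) / (1 - p) of Y turns Y h(p) into the mean of - (b + 1) ln (1 - p) - j ln p. The
    parameters [y0] and q enter later, as affine corrections. *)
Lemma series_divergence (R : realType) (p : R) b : 0 < p < 1 ->
  series (fun j => nbinom p b.+1 j * (ln (nbinom p b.+1 j) - log_weight p (b.+1 + j))) @ \oo --> (0 : R).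
Proof.
move=> p01; have /andP[p0 p1] := p01; have a0 : 0 < 1 - p by rewrite subr_gt0.
set h := binary_entropy p.
have -> : (fun j => nbinom p b.+1 j * (ln (nbinom p b.+1 j) - log_weight p (b.+1 + j))) =
  (fun j => nbinom p b.+1 j * Lambda1 p (b.+1 + j) +
    (nbinom p b.+1 j * (Lambda2 p (b.+1 + j) - ln j`!%:R) +
    ((b.+1%:R * (ln (1 - p) - ln p) - ln b`!%:R) * nbinom p b.+1 j +
     (ln p + h) * (nbinom p b.+1 j * (b.+1 + j)%:R)))).
  apply/funext => j.
  have binE : ln 'C(b + j, j)%:R = ln (b + j)`!%:R - ln j`!%:R - ln b`!%:R :> R.
    have : (0 < 'C(b + j, j))%N by rewrite bin_gt0 leq_addl.
    have := bin_fact (leq_addl b j); rewrite addnK => <-.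
    rewrite !natrM => c0; rewrite !lnM ?posrE ?mulr_gt0 ?ltr0n ?fact_gt0//; ring.
  have -> : ln (nbinom p b.+1 j) = ln (b + j)`!%:R - ln j`!%:R - ln b`!%:R +
      b.+1%:R * ln (1 - p) + j%:R * ln p.
    rewrite /nbinom addSn/= !lnM ?posrE ?mulr_gt0 ?exprn_gt0 ?ltr0n ?bin_gt0 ?leq_addl//.
    by rewrite binE !lnXn// -[ln p *+ _]mulr_natl -[_ *+ b.+1]mulr_natl.
  by rewrite /log_weight -/h addSn /= -addSn natrD; ring.
have -> : 0 = ln b`!%:R + (0 + ((b.+1%:R * (ln (1 - p) - ln p) - ln b`!%:R) * 1 +
   (ln p + h) * (b.+1%:R / (1 - p)))).
  by rewrite /h /binary_entropy; field; rewrite gt_eqF.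
apply: cvg_seriesD; first exact: series_Lambda1.
apply: cvg_seriesD; first exact: series_Lambda2.
apply: cvg_seriesD; apply: cvg_seriesZ; first exact: series_nbinom.
exact: series_nbinom_mean.
Qed.

(** The total mass G is left free: u will be a tail of the weights, or the reference law times a
    test function, and the latter choice is the Donsker-Varadhan inequality. *)
Lemma gibbs_inequality (R : realType) (P u : nat -> R) (G c : R) :
  (forall j, 0 < P j) -> (forall j, 0 < u j) ->
  series P @ \oo --> (1 : R) -> series u @ \oo --> G ->
  series (fun j => P j * (ln (P j) - ln (u j))) @ \oo --> c -> - ln G <= c.
Proof.
move=> P0 u0 P1 uG Pc.
have G0 : 0 < G.
  apply: (lt_le_trans (u0 0%N)); have -> : u 0%N = series u 1 by rewrite /series/= big_nat1.
  have <- : limn (series u) = G by exact/cvg_lim.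
  apply: nondecreasing_cvgn_le; last by apply/cvg_ex; exists G.
  by apply: nondecreasing_series => j _ _; exact: ltW.
(* The added terms sum to ln G, and by ln x <= x - 1 at x = u_j / (P_j G) they make every term
   nonnegative. *)
have H : series (fun j => P j * (ln (P j) - ln (u j)) + (ln G * P j + (G^-1 * u j + -1 * P j))) @ \oo -->
    c + (ln G * 1 + (G^-1 * G + -1 * 1)).
  apply: cvg_seriesD => //; apply: cvg_seriesD; first exact: cvg_seriesZ.
  by apply: cvg_seriesD; exact: cvg_seriesZ.
suff : 0 <= c + (ln G * 1 + (G^-1 * G + -1 * 1)).
  by rewrite mulVf ?gt_eqF// !mulr1 subrr addr0 addrC -lerBlDl sub0r.
rewrite -(cvg_lim _ H)//; apply: limr_ge; first by apply/cvg_ex; eexists; exact: H.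
apply: nearW => n; apply: sumr_ge0 => j _.
have x0 : 0 < u j / (P j * G) by rewrite divr_gt0// mulr_gt0.
have := @le_ln1Dx R (u j / (P j * G) - 1); rewrite ltrBDr addrC subrr x0 => /(_ isT).
rewrite addrC subrK ln_div ?posrE ?mulr_gt0// lnM ?posrE// => h.
have := ler_wpM2l (ltW (P0 j)) h.
have -> : P j * (u j / (P j * G) - 1) = G^-1 * u j - P j by field; rewrite !gt_eqF.
lra.
Qed.

(** * Power series of the weights *)

(** Equivalent to a radius of convergence of at least 1. This form passes easily to sums, shifts and
    multiples by k + 1, hence to formal derivatives. *)
Definition subexponential (R : realType) (c : nat -> R) : Prop :=
  forall r : R, 0 < r < 1 -> exists B : R, forall k, `|c k| * r ^+ k <= B.

Lemma subexponentialD (R : realType) (c d : nat -> R) :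
  subexponential c -> subexponential d -> subexponential (fun k => c k + d k).
Proof.
move=> sc sd r r01; have [B cB] := sc r r01; have [B' dB] := sd r r01.
exists (B + B') => k; apply: (le_trans _ (lerD (cB k) (dB k))).
by rewrite -mulrDl ler_wpM2r ?ler_normD// exprn_ge0//; have /andP[/ltW] := r01.
Qed.

Lemma subexponentialZ (R : realType) (a : R) (c : nat -> R) :
  subexponential c -> subexponential (fun k => a * c k).
Proof.
move=> sc r r01; have [B cB] := sc r r01; exists (`|a| * B) => k.
by rewrite normrM -mulrA ler_wpM2l.
Qed.

Lemma subexponential_shift (R : realType) (c : nat -> R) :
  subexponential c -> subexponential (fun k => c k.+1).
Proof.
move=> sc r r01; have /andP[r0 r1] := r01.
have [B cB] := sc r r01; exists (B / r) => k.
by rewrite ler_pdivlMr// -mulrA -exprSr.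
Qed.

Lemma natS_exprn_le (R : realType) (t : R) k : 0 < t < 1 ->
  k.+1%:R * t ^+ k <= (- ln t)^-1 / t.
Proof.
move=> /andP[t0 t1]; have l0 : 0 < - ln t by rewrite oppr_gt0 ln_lt0// t0.
rewrite ler_pdivlMr// -mulrA -exprSr -[leRHS]mul1r ler_pdivlMr//.
have h : k.+1%:R * - ln t <= t ^- k.+1.
  have -> : t ^- k.+1 = expR (k.+1%:R * - ln t).
    by rewrite expRM_natl expRN lnK ?posrE// exprVn.
  by apply: le_trans (expR_ge1Dx _); rewrite lerDr.
rewrite mulrAC -[leRHS](@mulVf _ (t ^+ k.+1)); last by rewrite expf_neq0// gt_eqF.
by rewrite ler_wpM2r ?exprn_ge0// ltW.
Qed.

Lemma subexponential_natS (R : realType) (c : nat -> R) :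
  subexponential c -> subexponential (fun k => k.+1%:R * c k).
Proof.
move=> sc r /andP[r0 r1].
(* Room between r and 1: r = t s, where t^k absorbs the factor k + 1 and s^k the coefficient. *)
pose s := (1 + r) / 2; have s01 : 0 < s < 1 by rewrite /s; apply/andP; split; lra.
have s0 : 0 < s by have /andP[] := s01.
pose t := r / s; have t01 : 0 < t < 1.
  by rewrite divr_gt0//= ltr_pdivrMr// mul1r /s; lra.
have [B cB] := sc s s01; exists ((- ln t)^-1 / t * B) => k.
have -> : r = t * s by rewrite /t divfK// gt_eqF.
rewrite normrM normr_nat exprMn mulrACA; apply: ler_pM => //.
  by rewrite mulr_ge0// exprn_ge0//; have /andP[/ltW] := t01.
- by rewrite mulr_ge0// exprn_ge0// ltW.
- exact: natS_exprn_le.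
Qed.

Lemma subexponential_cvg (R : realType) (c : nat -> R) (q : R) : 0 < q < 1 ->
  subexponential c -> cvgn (series (fun k => c k * q ^+ k)).
Proof.
move=> /andP[q0 q1] sc.
pose s := (1 + q) / 2; have s01 : 0 < s < 1 by rewrite /s; apply/andP; split; lra.
have s0 : 0 < s by have /andP[] := s01.
have [B cB] := sc s s01.
have t1 : q / s < 1 by rewrite ltr_pdivrMr// mul1r /s; lra.
have t0 : 0 <= q / s by rewrite divr_ge0// ltW.
apply: normed_cvg; apply: (@series_le_cvg _ _ (fun k => B * (q / s) ^+ k)) => //.
- by move=> k /=.
- by move=> k; rewrite mulr_ge0 ?exprn_ge0// (le_trans _ (cB 0%N))// mulr_ge0// exprn_ge0// ltW.
- move=> k /=; rewrite normrM [X in _ * X]ger0_norm; last by rewrite exprn_ge0// ltW.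
  have -> : q ^+ k = s ^+ k * (q / s) ^+ k by rewrite -exprMn mulrCA divff ?mulr1// gt_eqF.
  by rewrite mulrA ler_wpM2r// exprn_ge0.
- by apply: is_cvg_geometric_series; rewrite ger0_norm.
Qed.

(** A linear bound of arbitrarily small slope is all that subexponential growth needs, so the
    increments O(1 / k) need not be summed to a logarithm. *)
Lemma log_weight_growth (R : realType) (p e : R) : 0 < p < 1 -> 0 < e ->
  exists B, forall k, log_weight p k.+1 <= B + e * k%:R.
Proof.
move=> p01 e0; set C := 2 / (1 - p) ^+ 2 + 1.
have C0 : 0 <= C by rewrite addr_ge0// divr_ge0// exprn_ge0// subr_ge0; have /andP[_ /ltW] := p01.
(* From N on the increments C / (k + 1) are at most e; each earlier one is at most C. *)
pose N := (Num.truncn (C / e)).+1.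
have NC : C <= e * N%:R.
  by rewrite mulrC -ler_pdivrMr//; apply: ltW; exact: truncnS_gt.
suff H k : log_weight p k.+1 <= log_weight p 1 + C * (minn k N)%:R + e * k%:R.
  exists (log_weight p 1 + C * N%:R) => k; apply: (le_trans (H k)).
  by rewrite lerD2r lerD2l ler_wpM2l// ler_nat geq_minr.
elim: k => [|k IH]; first by rewrite min0n !mulr0 !addr0.
have := log_weight_step k p01; rewrite -/C => h.
have k0 : 0 < k.+1%:R :> R by rewrite ltr0n.
have [kN|Nk] := ltnP k N.
  have -> : minn k.+1 N = (minn k N).+1 by rewrite (minn_idPl kN) (minn_idPl (ltnW kN)).
  have : C / k.+1%:R <= C by rewrite ler_pdivrMr// ler_peMr// ler1n.
  move=> h2; apply: (@le_trans _ _ (log_weight p k.+1 + C)); first by rewrite -lerBlDl; exact: le_trans h h2.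
  clear h h2.
  rewrite -(@natr1 R k) -(@natr1 R (minn k N)); lra.
have -> : minn k.+1 N = minn k N by rewrite (minn_idPr Nk) (minn_idPr (leqW Nk)).
have : C / k.+1%:R <= e.
  rewrite ler_pdivrMr//; apply: (le_trans NC); rewrite ler_wpM2l ?(ltW e0)// ler_nat.
  exact: leqW.
move=> h2; apply: (@le_trans _ _ (log_weight p k.+1 + e)); first by rewrite -lerBlDl; exact: le_trans h h2.
clear h h2.
rewrite -(@natr1 R k); lra.
Qed.

Lemma subexponential_weight (R : realType) (p : R) : 0 < p < 1 ->
  subexponential (fun k => expR (log_weight p k.+1)).
Proof.
move=> p01 r /andP[r0 r1].
have e0 : 0 < - ln r by rewrite oppr_gt0 ln_lt0// r0.
have [B LB] := log_weight_growth p01 e0; exists (expR B) => k.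
have -> : r ^+ k = expR (k%:R * ln r) by rewrite expRM_natl lnK.
rewrite gtr0_norm ?expR_gt0// -expRD ler_expR; have := LB k; lra.
Qed.

Lemma Y_weightE (R : realType) (p q : R) y : Y_weight p q y = q ^+ y * expR (log_weight p y).
Proof. by []. Qed.

Lemma Y_weight_gt0 (R : realType) (p q : R) y : 0 < q -> 0 < Y_weight p q y.
Proof. by move=> q0; rewrite Y_weightE mulr_gt0 ?exprn_gt0 ?expR_gt0. Qed.

Lemma ln_Y_weight (R : realType) (p q : R) y : 0 < q ->
  ln (Y_weight p q y) = y%:R * ln q + log_weight p y.
Proof.
by move=> q0; rewrite Y_weightE lnM ?posrE ?exprn_gt0 ?expR_gt0// expRK lnXn// mulr_natl.
Qed.

Lemma series_Y_weight_cvg (R : realType) (p q : R) : 0 < p < 1 -> 0 < q < 1 ->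
  cvgn (series (fun k => Y_weight p q k.+1)).
Proof.
move=> p01 q01; have /cvg_ex[l cl] := subexponential_cvg q01 (subexponential_weight p01).
apply/cvg_ex; exists (q * l).
have -> : (fun k => Y_weight p q k.+1) = (fun k => q * (expR (log_weight p k.+1) * q ^+ k)).
  by apply/funext => k; rewrite Y_weightE exprS; ring.
exact: cvg_seriesZ.
Qed.

Lemma Y_norm_lim (R : realType) (p q : R) : 0 < p < 1 -> 0 < q < 1 ->
  Y_norm p q = (limn (series (fun k => Y_weight p q k.+1)))%:E.
Proof.
move=> p01 q01; rewrite /Y_norm -nneseries_addn; last first.
  by move=> k; rewrite lee_fin ltW// Y_weight_gt0//; have /andP[] := q01.
under eq_eseriesr do rewrite addn1.
by apply: eseries_of_cvg_series; exact: series_Y_weight_cvg.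
Qed.

Lemma Y_norm_gt0 (R : realType) (p q : R) : 0 < p < 1 -> 0 < q < 1 ->
  0 < limn (series (fun k => Y_weight p q k.+1)).
Proof.
move=> p01 q01; have /andP[q0 _] := q01.
apply: (@lt_le_trans _ _ (series (fun k => Y_weight p q k.+1) 1)).
  by rewrite /series/= big_nat1 Y_weight_gt0.
apply: nondecreasing_cvgn_le; last exact: series_Y_weight_cvg.
by apply: nondecreasing_series => k _ _; rewrite ltW// Y_weight_gt0.
Qed.

Lemma cvg_series_shift (R : realType) (u : nat -> R) (l : R) b :
  series u @ \oo --> l ->
  series (fun j => u (b + j)%N) @ \oo --> l - \sum_(0 <= j < b) u j.
Proof.
move=> ul.
have -> : series (fun j => u (b + j)%N) = (fun n => series u (n + b)%N - \sum_(0 <= j < b) u j).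
  apply/funext => n; rewrite /series/= (@big_cat_nat _ _ _ b 0 (n + b))//=; last exact: leq_addl.
  have -> : \sum_(b <= i < n + b) u i = \sum_(0 <= k < n) u (b + k)%N.
    rewrite -{1}[b]add0n big_addn addnK.
    by apply: eq_bigr => j _; rewrite addnC.
  by rewrite [X in X - _]addrC addrK.
by apply: cvgB; [rewrite (cvg_shiftn b)|exact: cvg_cst].
Qed.

(* Gibbs' inequality against the negative binomial law started at b + 1. *)
Lemma Y_weight_tail (R : realType) (p q G : R) b : 0 < p < 1 -> 0 < q < 1 ->
  series (fun j => Y_weight p q (b.+1 + j)) @ \oo --> G ->
  - ln G <= - (b.+1%:R / (1 - p)) * ln q.
Proof.
move=> p01 q01 wG; have /andP[q0 _] := q01.
apply: (@gibbs_inequality _ (nbinom p b.+1) (fun j => Y_weight p q (b.+1 + j))) => //.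
- by move=> j; exact: nbinom_gt0.
- by move=> j; exact: Y_weight_gt0.
- exact: series_nbinom.
have -> : (fun j => nbinom p b.+1 j * (ln (nbinom p b.+1 j) - ln (Y_weight p q (b.+1 + j)))) =
   (fun j => nbinom p b.+1 j * (ln (nbinom p b.+1 j) - log_weight p (b.+1 + j)) +
     (- ln q) * (nbinom p b.+1 j * (b.+1 + j)%:R)).
  by apply/funext => j; rewrite ln_Y_weight//; ring.
have -> : - (b.+1%:R / (1 - p)) * ln q = 0 + - ln q * (b.+1%:R / (1 - p)) by ring.
apply: cvg_seriesD; first exact: series_divergence.
by apply: cvg_seriesZ; exact: series_nbinom_mean.
Qed.

(** * The mean of the reference law as a function of q *)

Lemma subexponential_continuous (R : realType) (c : nat -> R) (x : R) :
  subexponential c -> `|x| < 1 ->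
  {for x, continuous (fun x => limn (pseries c x))}.
Proof.
move=> sc x1.
(* Differentiability at x is deduced from convergence of the series and of its first two formal
   derivatives at a point s beyond |x|. *)
pose s := (1 + `|x|) / 2; have s01 : 0 < s < 1.
  by have := normr_ge0 x; rewrite /s => ?; apply/andP; split; lra.
have cc (d : nat -> R) : subexponential d -> cvgn (pseries d s).
  by move=> sd; exact: subexponential_cvg.
have sd (d : nat -> R) : subexponential d -> subexponential (pseries_diffs d).
  move=> sd r r01.
  have := subexponential_natS (subexponential_shift sd) r01.
  by [].
have := @pseries_snd_diffs _ c s x (cc _ sc) (cc _ (sd _ sc)) (cc _ (sd _ (sd _ sc))).
rewrite [ltRHS]ger0_norm; last by have /andP[/ltW] := s01.
move=> /(_ _)[]; first by rewrite /s; lra.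
move=> df _; apply: differentiable_continuous; exact/derivable1_diffP.
Qed.

(** For q in ]0, 1[, the power series in q with these coefficients, times the positive factor
    [q * y0 p q], is the mean of Y^(q) minus mu. Its zeros there are the required q, and no quotient
    of series has to be shown continuous. *)
Definition centered_coef (R : realType) (p mu : R) (k : nat) : R :=
  (k.+1%:R - mu) * expR (log_weight p k.+1).

Lemma subexponential_centered (R : realType) (p mu : R) : 0 < p < 1 ->
  subexponential (centered_coef p mu).
Proof.
move=> p01.
have -> : centered_coef p mu = (fun k => k.+1%:R * expR (log_weight p k.+1) +
    (- mu) * expR (log_weight p k.+1)).
  by apply/funext => k; rewrite /centered_coef mulrBl mulNr.
apply: subexponentialD; first by apply: subexponential_natS; exact: subexponential_weight.
by apply: subexponentialZ; exact: subexponential_weight.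
Qed.

(* The tail from b on has mass at least q ^ (b / (1-p)), which is 1/2 for the chosen q;
   b is large enough for the coefficients of the tail to outweigh the negative head. *)
Lemma centered_series_pos (R : realType) (p mu : R) : 0 < p < 1 -> 0 <= mu ->
  exists q : R, 0 < q < 1 /\ 0 <= limn (pseries (centered_coef p mu) q).
Proof.
move=> p01 mu0; have /andP[p0 p1] := p01.
have a0 : 0 < 1 - p by rewrite subr_gt0.
pose K := (Num.truncn mu).+1.
have muK : mu < K%:R by exact: truncnS_gt.
(* S bounds the loss from the head uniformly in q <= 1, so b can be fixed first and q chosen from b.
   Tail coefficients of at least 2 (S + 1), with tail mass at least 1/2, contribute S + 1. *)
pose S := \sum_(0 <= k < K) mu * expR (log_weight p k.+1).
have S0 : 0 <= S by apply: sumr_ge0 => k _; rewrite mulr_ge0// expR_ge0.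
pose b := maxn K (Num.truncn (mu + 2 * (S + 1))).+1.
have bK : (K <= b)%N by exact: leq_maxl.
have bS : mu + 2 * (S + 1) <= b%:R.
  apply: (@le_trans _ _ (Num.truncn (mu + 2 * (S + 1))).+1%:R); first by apply: ltW; exact: truncnS_gt.
  by rewrite ler_nat leq_maxr.
(* Chosen so that q^((b + 1) / (1 - p)) = 1/2. *)
pose q := expR (- ((1 - p) / b.+1%:R) * ln 2).
have l2 : 0 < ln 2 :> R by rewrite ln_gt0// ltr1n.
have q0 : 0 < q by exact: expR_gt0.
have q1 : q < 1 by rewrite expR_lt1 mulNr oppr_lt0 mulr_gt0// divr_gt0.
have q01 : 0 < q < 1 by rewrite q0.
exists q; split => //.
pose t k := (k.+1%:R - mu) * Y_weight p q k.+1.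
have /cvg_ex[/= T tT] : cvgn (series (fun k => centered_coef p mu k * q ^+ k)).
  by apply: subexponential_cvg => //; exact: subexponential_centered.
have -> : limn (pseries (centered_coef p mu) q) = T by exact/cvg_lim.
have tqT : series t @ \oo --> q * T.
  have -> : t = (fun k => q * (centered_coef p mu k * q ^+ k)).
    by apply/funext => k; rewrite /t /centered_coef Y_weightE exprS; ring.
  exact: cvg_seriesZ.
suff : 0 <= q * T by rewrite pmulr_rge0.
have w0 k : 0 < Y_weight p q k by exact: Y_weight_gt0.
have /cvg_ex[/= W cW] := series_Y_weight_cvg p01 q01.
have cG := @cvg_series_shift _ _ _ b cW.
set G := (W - _) in cG.
have G2 : 2^-1 <= G.
  have G0 : 0 < G.
    apply: (@lt_le_trans _ _ (series (fun j => Y_weight p q (b + j).+1) 1)).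
      by rewrite /series/= big_nat1.
    rewrite -(cvg_lim _ cG)//; apply: nondecreasing_cvgn_le; last by apply/cvg_ex; exists G.
    by apply: nondecreasing_series => k _ _; exact: ltW.
  have := @Y_weight_tail _ p q G b p01 q01 cG.
  have -> : - (b.+1%:R / (1 - p)) * ln q = ln 2.
    by rewrite /q expRK mulrA mulrNN -[_ / (1 - p)]invf_div mulVf ?mul1r// gt_eqF// divr_gt0.
  rewrite -ler_expR expRN !lnK ?posrE// => h.
  by rewrite invf_ple ?posrE.
have tb := @cvg_series_shift _ _ _ b tqT.
have head : - S <= \sum_(0 <= k < b) t k.
  rewrite (@big_cat_nat _ _ _ K 0 b)//= /S -sumrN -[leLHS]addr0; apply: lerD.
    apply: ler_sum => k _; rewrite /t mulrBl.
    have h1 : 0 <= k.+1%:R * Y_weight p q k.+1 by rewrite mulr_ge0// ltW.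
    have h2 : mu * Y_weight p q k.+1 <= mu * expR (log_weight p k.+1).
      rewrite ler_wpM2l// Y_weightE ler_piMl ?expR_ge0//.
      by rewrite exprn_ile1// ltW.
    lra.
  rewrite big_nat_cond; apply: sumr_ge0 => k; rewrite andbT => /andP[Kk _].
  apply: mulr_ge0; last exact: ltW.
  have : K%:R <= k.+1%:R :> R by rewrite ler_nat leqW.
  lra.
have tail : 2 * (S + 1) * G <= q * T - \sum_(0 <= k < b) t k.
  apply: (ler_cvg_to (cvg_seriesZ (c := 2 * (S + 1)) cG) tb); apply: nearW => n.
  apply: ler_sum => j _; rewrite /t; apply: ler_wpM2r; first exact: ltW.
  have : b%:R <= (b + j).+1%:R :> R by rewrite ler_nat -addnS leq_addr.
  by move=> h; rewrite lerBrDr addrC; exact: le_trans bS h.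
have : (S + 1) * 1 <= (S + 1) * (2 * G) by apply: ler_wpM2l; lra.
lra.
Qed.

Lemma Y_mean_surj (R : realType) (p mu : R) : 0 < p < 1 -> 1 < mu ->
  exists q : R, 0 < q < 1 /\ Y_mean p q = mu%:E.
Proof.
move=> p01 mu1; have mu0 : 0 <= mu by lra.
pose H (x : R) := limn (pseries (centered_coef p mu) x).
have [q1 [q101 Hq1]] := centered_series_pos p01 mu0.
have /andP[q10 q11] := q101.
(* At q = 0 only the first coefficient remains; it has the sign of 1 - mu. *)
have H0 : H 0 < 0.
  have -> : H 0 = centered_coef p mu 0.
    apply/cvg_lim => //; rewrite -cvg_shiftS.
    have -> : (fun n => pseries (centered_coef p mu) 0 n.+1) = cst (centered_coef p mu 0).
      apply/funext => n; rewrite /pseries/series/= big_nat_recl// expr0 mulr1.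
      by rewrite big1 ?addr0// => i _; rewrite expr0n mulr0.
    exact: cvg_cst.
  by rewrite /centered_coef nmulr_rlt0 ?expR_gt0// subr_lt0.
have [q] : exists2 q, q \in `[0, q1] & H q = 0.
  apply: IVT; first exact: ltW.
    apply: continuous_in_subspaceT => x; rewrite inE/= in_itv/= => /andP[x0 xq].
    apply: subexponential_continuous; first exact: subexponential_centered.
    by rewrite ger0_norm//; lra.
  by rewrite ge_min le_max (ltW H0) Hq1 orbT.
rewrite in_itv/= => /andP[]; rewrite le_eqVlt => /predU1P[<- _ H00|q0 qq1 Hq].
  by move: H0; rewrite H00 ltxx.
have q01 : 0 < q < 1 by rewrite q0/=; lra.
exists q; split => //.
have cw := series_Y_weight_cvg p01 q01; have W0 := Y_norm_gt0 p01 q01.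
set W := limn _ in cw W0.
have cH : series (fun k => q * (centered_coef p mu k * q ^+ k)) @ \oo --> q * 0.
  apply: cvg_seriesZ; rewrite -Hq.
  by apply: subexponential_cvg => //; exact: subexponential_centered.
rewrite /Y_mean -nneseries_addn; last first.
  move=> k; rewrite lee_fin; apply: mulr_ge0; last by rewrite ltW// Y_weight_gt0.
  by apply: mulr_ge0 => //; rewrite /y0 Y_norm_lim//= invr_ge0 ltW.
under eq_eseriesr do rewrite addn1.
have -> : mu = W^-1 * (q * 0 + mu * W) by rewrite mulr0 add0r mulrC mulfK// gt_eqF.
apply: eseries_of_cvg_series.
have -> : (fun k => y0 p q * k.+1%:R * Y_weight p q k.+1) =
   (fun k => W^-1 * (q * (centered_coef p mu k * q ^+ k) + mu * Y_weight p q k.+1)).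
  apply/funext => k; rewrite /y0 Y_norm_lim//= /centered_coef Y_weightE exprS -/W.
  ring.
by apply: cvg_seriesZ; apply: cvg_seriesD => //; exact: cvg_seriesZ.
Qed.

Lemma mu_bound_le_q_bound (R : realType) (p : R) : 0 < p < 1 ->
  (mu_bound p <= q_bound p)%E.
Proof.
move=> p01; have /andP[p0 p1] := p01; have a0 : 0 < 1 - p by rewrite subr_gt0.
apply: ge_ereal_sup => _ [mu /= muge <-].
have mu1 : 1 < mu.
  by apply: lt_le_trans muge; rewrite mul1r invf_gt1// ltrBlDr ltrDl.
have [q [q01 Yq]] := Y_mean_surj p01 mu1.
have muap : 0 < mu * (1 - p) by rewrite mulr_gt0//; lra.
rewrite inver gt_eqF// lee_pdivrMr//.
apply: (@le_trans _ _ (- ln (y0 p q) - mu * ln q)%:E).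
  by apply: ereal_inf_lbound; exists q.
rewrite -lee_pdivrMr//; apply: ereal_sup_ubound; exists q => /=.
  by rewrite Yq lee_fin.
by rewrite Yq /= EFinM.
Qed.

Lemma Y_norm_lty (R : realType) (p q : R) : 0 < p < 1 -> 0 < q < 1 -> (Y_norm p q < +oo)%E.
Proof. by move=> p01 q01; rewrite Y_norm_lim// ltry. Qed.

(** * Means over concatenated random strings *)

Definition is_pmf (R : realType) (P : nat -> R) : Prop :=
  (forall i, 0 <= P i) /\ series P @ \oo --> (1 : R).

Definition mean (R : realType) (P f : nat -> R) : R := limn (series (fun i => P i * f i)).

Lemma mean_cvg (R : realType) (P f : nat -> R) (B : R) : is_pmf P ->
  (forall i, `|f i| <= B) -> series (fun i => P i * f i) @ \oo --> mean P f.
Proof.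
move=> [P0 P1] fB; apply: normed_cvg.
apply: (@series_le_cvg _ _ (fun i => B * P i)) => //.
- by move=> i /=.
- by move=> i; rewrite mulr_ge0// (le_trans _ (fB 0%N)).
- by move=> i /=; rewrite normrM ger0_norm// mulrC ler_wpM2r.
- by apply/cvg_ex; exists (B * 1); exact: cvg_seriesZ.
Qed.

Lemma mean_affine (R : realType) (P f : nat -> R) (B a c : R) : is_pmf P ->
  (forall i, `|f i| <= B) -> mean P (fun i => a + c * f i) = a + c * mean P f.
Proof.
move=> pP fB; apply/cvg_lim => //.
have -> : (fun i => P i * (a + c * f i)) = (fun i => a * P i + c * (P i * f i)).
  by apply/funext => i; ring.
rewrite -[in X in _ --> X](mulr1 a); apply: cvg_seriesD; apply: cvg_seriesZ; first exact: pP.2.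
exact: mean_cvg.
Qed.

Lemma mean_cst (R : realType) (P : nat -> R) (a : R) : is_pmf P -> mean P (fun=> a) = a.
Proof.
move=> pP; have := @mean_affine _ P (fun=> 0) 0 a 0 pP.
by rewrite !(mul0r, addr0); apply => i; rewrite normr0.
Qed.

Lemma le_mean (R : realType) (P f g : nat -> R) (B : R) : is_pmf P ->
  (forall i, `|f i| <= B) -> (forall i, `|g i| <= B) -> (forall i, f i <= g i) ->
  mean P f <= mean P g.
Proof.
move=> pP fB gB fg.
apply: (ler_cvg_to (mean_cvg pP fB) (mean_cvg pP gB)); apply: nearW => n.
by apply: ler_sum => i _; rewrite ler_wpM2l//; exact: pP.1.
Qed.

Lemma meanD (R : realType) (P f g : nat -> R) (B C : R) : is_pmf P ->
  (forall i, `|f i| <= B) -> (forall i, `|g i| <= C) ->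
  mean P (fun i => f i + g i) = mean P f + mean P g.
Proof.
move=> pP fB gB; apply/cvg_lim => //.
have -> : (fun i => P i * (f i + g i)) = (fun i => P i * f i + P i * g i).
  by apply/funext => i; ring.
by apply: cvg_seriesD; apply: mean_cvg; eassumption.
Qed.

Lemma norm_between (R : realType) (l u x : R) : l <= x <= u -> `|x| <= `|l| + `|u|.
Proof.
move=> /andP[lx xu]; rewrite ler_norml; apply/andP; split.
  by have := ler_norm (- l); rewrite normrN; have := normr_ge0 u; lra.
by have := ler_norm u; have := normr_ge0 l; lra.
Qed.

Lemma mean_between (R : realType) (P f : nat -> R) (l u : R) : is_pmf P ->
  (forall i, l <= f i <= u) -> l <= mean P f <= u.
Proof.
move=> pP flu; apply/andP; split.
  rewrite -[leLHS](mean_cst l pP); apply: (@le_mean _ _ _ _ (`|l| + `|u|)) => // i.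
  - by rewrite lerDl.
  - exact: norm_between.
  - by have /andP[] := flu i.
rewrite -[leRHS](mean_cst u pP); apply: (@le_mean _ _ _ _ (`|l| + `|u|)) => // i.
- exact: norm_between.
- by rewrite lerDr.
- by have /andP[] := flu i.
Qed.

(* Expectation of f on the concatenation of independent random strings;
   the pair (P, s) is the string s i with probability P i. *)
Fixpoint concat_mean (R : realType) (l : seq ((nat -> R) * (nat -> seq bool)))
    (f : seq bool -> R) : R :=
  if l is (P, s) :: l' then mean P (fun i => concat_mean l' (fun z => f (s i ++ z)))
  else f [::].

Fixpoint all_pmf (R : realType) (l : seq ((nat -> R) * (nat -> seq bool))) : Prop :=
  if l is (P, _) :: l' then is_pmf P /\ all_pmf l' else True.

Lemma concat_mean_between (R : realType) l (f : seq bool -> R) (a b : R) : all_pmf l ->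
  (forall z, a <= f z <= b) -> a <= concat_mean l f <= b.
Proof.
elim: l f => [|[P s] l IH] f /=; first by move=> _.
by move=> [pP pl] fab; apply: mean_between => // i; apply: IH.
Qed.

Lemma concat_mean_norm (R : realType) l (f : seq bool -> R) (B : R) : all_pmf l ->
  (forall z, `|f z| <= B) -> `|concat_mean l f| <= B.
Proof.
move=> pl fB; rewrite ler_norml; apply: concat_mean_between => // z.
by rewrite -ler_norml.
Qed.

Lemma concat_mean_affine (R : realType) l (f : seq bool -> R) (B a c : R) : all_pmf l ->
  (forall z, `|f z| <= B) ->
  concat_mean l (fun z => a + c * f z) = a + c * concat_mean l f.
Proof.
elim: l f => [|[P s] l IH] f //= [pP pl] fB.
rewrite -(@mean_affine _ _ _ B)//; last by move=> i; exact: concat_mean_norm.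
by congr mean; apply/funext => i; rewrite IH.
Qed.

Lemma concat_meanD (R : realType) l (f g : seq bool -> R) (B C : R) : all_pmf l ->
  (forall z, `|f z| <= B) -> (forall z, `|g z| <= C) ->
  concat_mean l (fun z => f z + g z) = concat_mean l f + concat_mean l g.
Proof.
elim: l f g => [|[P s] l IH] f g //= [pP pl] fB gC.
rewrite -(@meanD _ _ _ _ B C)//; [|by move=> i; exact: concat_mean_norm..].
by congr mean; apply/funext => i; rewrite IH.
Qed.

Lemma concat_mean_cst (R : realType) l (a : R) : all_pmf l -> concat_mean l (fun=> a) = a.
Proof.
elim: l => [|[P s] l IH] //= [pP pl].
by under eq_fun do rewrite IH//; exact: mean_cst.
Qed.

Lemma concat_mean_sum (R : realType) l M (f : 'I_M -> seq bool -> R) : all_pmf l ->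
  (forall m z, `|f m z| <= 1) ->
  concat_mean l (fun z => \sum_(m < M) f m z) = \sum_(m < M) concat_mean l (f m).
Proof.
move=> pl; elim: M f => [|M IH] f fB.
  by under eq_fun do rewrite big_ord0; rewrite big_ord0 concat_mean_cst.
rewrite big_ord_recr/= -IH//; under eq_fun do rewrite big_ord_recr/=.
rewrite (@concat_meanD _ _ _ _ M%:R 1)// => z.
apply: (le_trans (ler_norm_sum _ _ _)).
by apply: (le_trans (ler_sum _ (fun i _ => fB _ z))); rewrite sumr_const card_ord.
Qed.

Definition run_law (R : realType) (p : R) (c : bool) (b : nat) :
    (nat -> R) * (nat -> seq bool) :=
  (nbinom p b, fun j => nseq (b + j) c).

Lemma nbinom_pmf (R : realType) (p : R) b : 0 < p < 1 -> is_pmf (nbinom p b).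
Proof. by move=> p01; split; [move=> i; exact: nbinom_ge0|exact: series_nbinom]. Qed.

Lemma eseries_mean (R : realType) (P f : nat -> R) (B : R) : is_pmf P ->
  (forall i, `|f i| <= B) -> (\sum_(i <oo) (P i * f i)%:E = (mean P f)%:E)%E.
Proof. by move=> pP fB; apply: eseries_of_cvg_series; exact: mean_cvg. Qed.

Lemma mean_nbinomS (R : realType) (p : R) b (g : nat -> R) : 0 < p < 1 ->
  (forall i, 0 <= g i <= 1) ->
  mean (nbinom p 1) (fun i => mean (nbinom p b) (fun j => g (i + j)%N)) =
  mean (nbinom p b.+1) g.
Proof.
move=> p01 g01; have pm b' := @nbinom_pmf R p b' p01.
have gn i : `|g i| <= 1 by have /andP[g0 g1] := g01 i; rewrite ger0_norm.
apply: EFin_inj.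
rewrite -(@eseries_mean _ _ _ 1)//; last first.
  move=> i; have /andP[m0 m1] := @mean_between _ _ _ 0 1 (pm b) (fun j => g01 (i + j)%N).
  by rewrite ger0_norm.
rewrite -(@eseries_mean _ _ _ 1)//.
have := @eseries_nbinomS _ p b (fun j => (g j)%:E) p01.
under eq_eseriesr do rewrite -EFinM.
move=> ->; last by move=> j; rewrite lee_fin; have /andP[] := g01 j.
apply: eq_eseriesr => i _; under eq_eseriesr do rewrite -EFinM.
rewrite (@eseries_mean _ _ _ 1)// -EFinM; congr (_ * _)%:E.
by rewrite /nbinom (_ : (1 + i).-1 = i)// binn mul1r expr1.
Qed.

(** The concatenated output depends only on the sum of the two excesses, and this sum is negative
    binomial with parameter b + 1. *)
Lemma concat_mean_merge (R : realType) (p : R) c b l (f : seq bool -> R) : 0 < p < 1 ->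
  all_pmf l -> (forall z, 0 <= f z <= 1) ->
  concat_mean (run_law p c 1 :: run_law p c b :: l) f =
  concat_mean (run_law p c b.+1 :: l) f.
Proof.
move=> p01 pl f01.
pose G j := concat_mean l (fun z => f (nseq (b.+1 + j) c ++ z)).
transitivity (mean (nbinom p 1) (fun i => mean (nbinom p b) (fun j => G (i + j)%N))).
  rewrite /=; congr mean; apply/funext => i; congr mean; apply/funext => j.
  rewrite /G; congr concat_mean; apply/funext => z; congr f.
  rewrite -[LHS]/(nseq (1 + i) c ++ (nseq (b + j) c ++ z)) catA -nseqD.
  by congr (nseq _ _ ++ _); lia.
by apply: mean_nbinomS => // j; exact: concat_mean_between.
Qed.

Definition bits_laws (R : realType) (p : R) (x : seq bool) := [seq run_law p c 1 | c <- x].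

(** The entries of [bs] are run lengths minus one, so that no run is empty; consecutive runs carry
    opposite bits. *)
Fixpoint runs_laws (R : realType) (p : R) (c : bool) (bs : seq nat) :=
  if bs is b :: bs' then run_law p c b.+1 :: runs_laws p (~~ c) bs' else [::].

Lemma all_pmf_bits (R : realType) (p : R) x : 0 < p < 1 -> all_pmf (bits_laws p x).
Proof. by move=> p01; elim: x => //= c x IH; split => //; exact: nbinom_pmf. Qed.

Lemma all_pmf_runs (R : realType) (p : R) c bs : 0 < p < 1 -> all_pmf (runs_laws p c bs).
Proof. by move=> p01; elim: bs c => //= b bs IH c; split; [exact: nbinom_pmf|exact: IH]. Qed.

(** The two lists of laws agree only after concatenation, hence the formulation by test functions. A
    new first bit either extends the first run or starts another. *)
Lemma run_decomposition (R : realType) (p : R) (x : seq bool) : 0 < p < 1 ->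
  exists c bs, (sumn bs + size bs)%N = size x /\
    forall f : seq bool -> R, (forall z, 0 <= f z <= 1) ->
      concat_mean (bits_laws p x) f = concat_mean (runs_laws p c bs) f.
Proof.
move=> p01; elim: x => [|c x [c' [bs [bsx IH]]]]; first by exists true, [::].
have E (f : seq bool -> R) : (forall z, 0 <= f z <= 1) ->
    concat_mean (bits_laws p (c :: x)) f = concat_mean (run_law p c 1 :: runs_laws p c' bs) f.
  by move=> f01 /=; congr mean; apply/funext => i; apply: IH.
case: bs bsx IH E => [|b bs] bsx IH E.
  by exists c, [:: 0%N]; split=> [|f f01]; [rewrite /= -bsx|rewrite E].
have [cc|cc] := eqVneq c c'; last first.
  exists c, (0%N :: b :: bs); split=> [|f f01]; first by rewrite /= -bsx /=; lia.
  by rewrite E//; have -> : c' = ~~ c by case: (c) (c') cc => [] [].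
exists c, (b.+1 :: bs); split=> [|f f01]; first by rewrite /= -bsx /=; lia.
rewrite E// -cc [runs_laws _ _ (b :: bs)]/= concat_mean_merge//.
exact: all_pmf_runs.
Qed.

(** * Divergence bounds for runs and the channel law *)

(** The law Y^(q) lives on positive lengths; index k stands for length k + 1. *)
Definition ref_pmf (R : realType) (p q : R) (k : nat) : R := y0 p q * Y_weight p q k.+1.

Definition ref_law (R : realType) (p q : R) (c : bool) :
    (nat -> R) * (nat -> seq bool) :=
  (ref_pmf p q, fun k => nseq k.+1 c).

Fixpoint ref_laws (R : realType) (p q : R) (c : bool) (k : nat) :=
  if k is k'.+1 then ref_law p q c :: ref_laws p q (~~ c) k' else [::].

Lemma y0_gt0 (R : realType) (p q : R) : 0 < p < 1 -> 0 < q < 1 -> 0 < y0 p q.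
Proof. by move=> p01 q01; rewrite /y0 Y_norm_lim// invr_gt0 Y_norm_gt0. Qed.

Lemma ref_pmf_gt0 (R : realType) (p q : R) k : 0 < p < 1 -> 0 < q < 1 -> 0 < ref_pmf p q k.
Proof.
by move=> p01 q01; rewrite mulr_gt0 ?y0_gt0// Y_weight_gt0//; have /andP[] := q01.
Qed.

Lemma ref_is_pmf (R : realType) (p q : R) : 0 < p < 1 -> 0 < q < 1 -> is_pmf (ref_pmf p q).
Proof.
move=> p01 q01; split; first by move=> k; rewrite ltW// ref_pmf_gt0.
have := cvg_seriesZ (c := y0 p q) (series_Y_weight_cvg p01 q01).
by rewrite {2}/y0 Y_norm_lim//= mulVf// gt_eqF// Y_norm_gt0.
Qed.

Lemma all_pmf_ref (R : realType) (p q : R) c k : 0 < p < 1 -> 0 < q < 1 ->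
  all_pmf (ref_laws p q c k).
Proof.
by move=> p01 q01; elim: k c => //= k IH c; split; [exact: ref_is_pmf|exact: IH].
Qed.

(* Donsker-Varadhan: the divergence of the output run length from the
   reference law is exactly [- ln y0 - E Y * ln q]. *)
Lemma run_divergence_bound (R : realType) (p q B : R) b (r : nat -> R) :
  0 < p < 1 -> 0 < q < 1 -> (forall k, 1 <= r k <= B) ->
  mean (nbinom p b.+1) (fun j => ln (r (b + j)%N)) <=
  - ln (y0 p q) - b.+1%:R / (1 - p) * ln q + ln (mean (ref_pmf p q) r).
Proof.
move=> p01 q01 rB; have /andP[q0 q1] := q01.
have r0 k : 0 < r k by have /andP[] := rB k; lra.
have lnr k : 0 <= ln (r k) <= ln B.
  have /andP[r1 rb] := rB k; rewrite ln_ge0//= ler_ln ?posrE//; lra.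
have rn k : `|r k| <= B by rewrite gtr0_norm//; have /andP[] := rB k.
have y00 := y0_gt0 p01 q01.
have m1 := mean_cvg (ref_is_pmf p01 q01) rn.
(* The output of b + 1 bits has length at least b + 1, that is, index at least b. Gibbs' inequality
   is applied to the tail G from b on, and the dropped head, being nonnegative, only weakens the
   bound. *)
have mG := @cvg_series_shift _ _ _ b m1.
set G := (_ - _) in mG.
have u0 j : 0 < ref_pmf p q (b + j) * r (b + j)%N by rewrite mulr_gt0// ref_pmf_gt0.
have GG : G <= mean (ref_pmf p q) r.
  rewrite /G gerBl; apply: sumr_ge0 => k _.
  by rewrite mulr_ge0// ltW// ref_pmf_gt0.
have G0 : 0 < G.
  apply: (@lt_le_trans _ _ (series (fun j => ref_pmf p q (b + j) * r (b + j)%N) 1)).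
    by rewrite /series/= big_nat1.
  rewrite -(cvg_lim _ mG)//; apply: nondecreasing_cvgn_le; last by apply/cvg_ex; exists G.
  by apply: nondecreasing_series => k _ _; exact: ltW.
have := @gibbs_inequality _ (nbinom p b.+1)
  (fun j => ref_pmf p q (b + j) * r (b + j)%N) G
  (0 + ((- ln (y0 p q)) * 1 + ((- ln q) * (b.+1%:R / (1 - p)) +
    (-1) * mean (nbinom p b.+1) (fun j => ln (r (b + j)%N)))))
  (fun j => nbinom_gt0 b j p01) u0 (series_nbinom b.+1 p01) mG.
have -> : (fun j => nbinom p b.+1 j * (ln (nbinom p b.+1 j) - ln (ref_pmf p q (b + j) * r (b + j)%N))) =
  (fun j => nbinom p b.+1 j * (ln (nbinom p b.+1 j) - log_weight p (b.+1 + j)) +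
    ((- ln (y0 p q)) * nbinom p b.+1 j +
     ((- ln q) * (nbinom p b.+1 j * (b.+1 + j)%:R) +
      (-1) * (nbinom p b.+1 j * ln (r (b + j)%N))))).
  apply/funext => j; rewrite lnM ?posrE ?ref_pmf_gt0//.
  have -> : ln (ref_pmf p q (b + j)) = ln (y0 p q) + ln (Y_weight p q (b.+1 + j)).
    by rewrite /ref_pmf lnM ?posrE// Y_weight_gt0.
  by rewrite ln_Y_weight//; ring.
have imp (A C D : Prop) : A -> (C -> D) -> (A -> C) -> D by auto.
apply: imp.
  apply: cvg_seriesD; first exact: series_divergence.
  apply: cvg_seriesD; first by apply: cvg_seriesZ; exact: series_nbinom.
  apply: cvg_seriesD; apply: cvg_seriesZ; first exact: series_nbinom_mean.
  apply: (mean_cvg (nbinom_pmf b.+1 p01) (B := ln B)) => j.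
  by have /andP[h1 h2] := lnr (b + j)%N; rewrite ger0_norm.
have : ln G <= ln (mean (ref_pmf p q) r) by rewrite ler_ln ?posrE//; exact: lt_le_trans GG.
have e (x y m l0 lq C : R) : x <= y -> - x <= 0 + (- l0 * 1 + (- lq * C + -1 * m)) ->
    m <= - l0 - C * lq + y by move=> ? ?; lra.
exact: e.
Qed.

(** Takes the place of the chain rule for divergence. The bounds 1 <= f <= B keep all logarithms
    bounded, so that every mean converges. *)
Lemma runs_divergence_bound (R : realType) (p q B : R) c bs (f : seq bool -> R) :
  0 < p < 1 -> 0 < q < 1 -> (forall z, 1 <= f z <= B) ->
  concat_mean (runs_laws p c bs) (fun z => ln (f z)) <=
  (size bs)%:R * - ln (y0 p q) - (sumn bs + size bs)%:R / (1 - p) * ln q +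
  ln (concat_mean (ref_laws p q c (size bs)) f).
Proof.
move=> p01 q01; elim: bs c f => [|b bs IH] c f fB; first by rewrite /= !mul0r subr0 add0r.
have lnf z : 0 <= ln (f z) <= ln B.
  have /andP[r1 rb] := fB z; rewrite ln_ge0//= ler_ln ?posrE//; lra.
(* All runs but the first are averaged out under the reference law. The induction hypothesis bounds
   the inner mean by A + ln r, and r is then the test function for the first run. *)
pose r k := concat_mean (ref_laws p q (~~ c) (size bs)) (fun z => f (nseq k.+1 c ++ z)).
have rB k : 1 <= r k <= B by apply: concat_mean_between => //; exact: all_pmf_ref.
have lnr k : 0 <= ln (r k) <= ln B.
  have /andP[r1 rb] := rB k; rewrite ln_ge0//= ler_ln ?posrE//; lra.
set A := (size bs)%:R * - ln (y0 p q) - (sumn bs + size bs)%:R / (1 - p) * ln q.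
apply: (@le_trans _ _ (mean (nbinom p b.+1) (fun j => A + 1 * ln (r (b + j)%N)))).
  apply: (@le_mean _ _ _ _ (`|A| + ln B)); first exact: nbinom_pmf.
  - move=> j; apply: (@le_trans _ _ (ln B)); last by rewrite lerDr.
    apply: concat_mean_norm; first exact: all_pmf_runs.
    by move=> z; have /andP[h1 h2] := lnf (nseq (b.+1 + j) c ++ z); rewrite ger0_norm.
  - move=> j; rewrite mul1r; apply: (le_trans (ler_normD _ _)); rewrite lerD2l.
    by have /andP[h1 h2] := lnr (b + j)%N; rewrite ger0_norm.
  - by move=> j; rewrite mul1r; exact: IH.
rewrite (@mean_affine _ _ _ (ln B)); last 2 first.
- exact: nbinom_pmf.
- by move=> j; have /andP[h1 h2] := lnr (b + j)%N; rewrite ger0_norm.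
have := @run_divergence_bound _ p q B b r p01 q01 rB.
rewrite [concat_mean (ref_laws _ _ _ _) _]/=.
have -> : (sumn (b :: bs) + size (b :: bs))%:R = (sumn bs + size bs)%:R + b.+1%:R :> R.
  by rewrite -natrD /=; congr (_%:R); lia.
rewrite /A /= -(@natr1 R (size bs)) mul1r !mulrDl mul1r -/r.
lra.
Qed.

(** * The channel output as a concatenation of geometric runs *)

Lemma geometric_step (R : realType) (p : R) c (x : seq bool) (k : R) (f : seq bool -> R) :
  0 < p < 1 -> (forall z, 0 <= f z <= 1) ->
  (\sum_(d <oo) (k * geometric_pmf p d *
      concat_mean (bits_laws p x) (fun z => f (nseq d c ++ z)))%:E =
   (k * concat_mean (bits_laws p (c :: x)) f)%:E)%E.
Proof.
move=> p01 f01.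
have g01 d : 0 <= concat_mean (bits_laws p x) (fun z => f (nseq d c ++ z)) <= 1.
  by apply: concat_mean_between; first exact: all_pmf_bits.
set g := (fun d => concat_mean (bits_laws p x) (fun z => f (nseq d c ++ z))) in g01 *.
apply: eseries_of_cvg_series.
have gn j : `|g (1 + j)%N| <= 1 by have /andP[h1 h2] := g01 (1 + j)%N; rewrite ger0_norm.
have := cvg_seriesZ (c := k) (mean_cvg (nbinom_pmf 1 p01) gn).
have <- : (fun n => series (fun d => k * geometric_pmf p d * g d) n.+1) =
    series (fun j => k * (nbinom p 1 j * g (1 + j)%N)).
  apply/funext => n.
  rewrite /series/= big_nat_recl//= {1}/geometric_pmf eqxx mulr0 mul0r add0r.
  apply: eq_bigr => j _; rewrite /geometric_pmf /= mulrA /nbinom (_ : (1 + j).-1 = j)//.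
  by rewrite binn mul1r expr1 add1n.
by rewrite cvg_shiftS.
Qed.

Lemma repeat_output_cons n c k (x : n.-tuple bool) (d : n.-tuple nat) :
  repeat_output [tuple of c :: x] [tuple of k :: d] = nseq k c ++ repeat_output x d.
Proof.
rewrite /repeat_output enum_ordSl /= !tnth0; congr (_ ++ flatten _).
by rewrite -map_comp; apply: eq_map => i /=; rewrite !tnthS.
Qed.

(** The factor k accumulates the masses of the replication counts already fixed, and E is pulled
    back along prepending their output; both must vary in the induction. *)
Lemma repeat_channel_concat_mean (R : realType) (p : R) n (x : n.-tuple bool) (k : R)
    (E : set (seq bool)) : 0 < p < 1 -> 0 <= k ->
  (\esum_(d in [set d : n.-tuple nat | E (repeat_output x d)])
     (k * \prod_(i < n) geometric_pmf p (tnth d i))%:E =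
   (k * concat_mean (bits_laws p x) \1_E)%:E)%E.
Proof.
move=> p01; have /andP[p0 p1] := p01.
have D0 d : 0 <= geometric_pmf p d.
  rewrite /geometric_pmf; case: ifP => // _.
  by rewrite mulr_ge0 ?exprn_ge0 ?subr_ge0// ltW.
elim: n x k E => [|n IH] x k E k0.
  rewrite (tuple0 x) /= indicE.
  have out d : repeat_output [tuple] d = [::] by rewrite /repeat_output enum_ord0.
  have [E0|E0] := boolP ([::] \in E).
    rewrite (_ : [set d | _] = [set [tuple]]).
      by rewrite esum_set1 ?big_ord0 ?mulr1// lee_fin.
    apply/seteqP; split => [d _|d _] /=; first by rewrite (tuple0 d).
    by rewrite out; exact: set_mem.
  rewrite (_ : [set d | _] = set0) ?esum_set0 ?mulr0//.
  apply/seteqP; split => // d /=; rewrite out => h.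
  by move/negP: E0; apply; rewrite inE.
case/tupleP: x => c x.
have E01 z : 0 <= (\1_E z : R) <= 1.
  by rewrite indicE; case: (_ \in _); rewrite ?lexx ler01.
pose J d := [set d' : n.-tuple nat | E (nseq d c ++ repeat_output x d')].
pose e (z : nat * n.-tuple nat) : n.+1.-tuple nat := [tuple of z.1 :: z.2].
rewrite (reindex_esum ([set: nat] `*`` J) _ e); last first.
  split.
  - by move=> [d d'] /= [_]; rewrite /J/= /e repeat_output_cons.
  - move=> [d d'] [a a'] _ _ /(congr1 val)/= [-> dd]; congr (_, _); exact: val_inj.
  - move=> t; case/tupleP: t => d d' /=; rewrite repeat_output_cons => h.
    by exists (d, d').
have P0 m (d : m.-tuple nat) : 0 <= \prod_(i < m) geometric_pmf p (tnth d i).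
  by apply: prodr_ge0 => i _.
transitivity (\esum_(d in [set: nat]) \esum_(d' in J d)
    (k * geometric_pmf p d * \prod_(i < n) geometric_pmf p (tnth d' i))%:E)%E.
  rewrite esum_esum; last by move=> d d' _ _; rewrite lee_fin !mulr_ge0.
  apply: eq_esum => -[d d'] _ /=; rewrite big_ord_recl tnth0 mulrA.
  by congr (_ * _)%:E; apply: eq_bigr => i _; rewrite tnthS.
transitivity (\esum_(d in [set: nat]) (k * geometric_pmf p d *
    concat_mean (bits_laws p x) (fun z => \1_E (nseq d c ++ z)))%:E)%E.
  apply: eq_esum => d _; rewrite (IH x _ [set z | E (nseq d c ++ z)])//; last exact: mulr_ge0.
rewrite -nneseries_esumT; last first.
  move=> d; rewrite lee_fin mulr_ge0 ?mulr_ge0//.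
  by have /andP[] := @concat_mean_between _ (bits_laws p x)
    (fun z => \1_E (nseq d c ++ z)) 0 1 (all_pmf_bits _ p01) (fun z => E01 _).
by rewrite geometric_step.
Qed.

(** * The coding converse *)

Lemma repeat_channelE (R : realType) (p : R) n (x : n.-tuple bool) (E : set (seq bool)) :
  0 < p < 1 ->
  repeat_channel (geometric_pmf p) x E = (concat_mean (bits_laws p x) \1_E)%:E.
Proof.
move=> p01; have := repeat_channel_concat_mean x E p01 ler01.
by rewrite mul1r => <-; apply: eq_esum => d _; rewrite mul1r.
Qed.

(** The tangent of ln at c. Used with one c for all messages, it plays the part of Jensen's
    inequality. *)
Lemma ln_le_affine (R : realType) (x c : R) : 0 < x -> 0 < c -> ln x <= ln c + x / c - 1.
Proof.
move=> x0 c0; have xc : 0 < x / c by rewrite divr_gt0.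
have h := @le_ln1Dx R (x / c - 1); have e : 1 + (x / c - 1) = x / c by ring.
rewrite e in h; have /h : -1 < x / c - 1 by lra.
by rewrite ln_div ?posrE//; lra.
Qed.

(** For a fixed first bit and number of runs the decoding sets partition the strings, so their
    masses add up to 1. Enlarging each term to a sum over all 2 (n + 1) such pairs allows the sums
    to be exchanged. *)
Lemma ref_decoding_mass (R : realType) (p q : R) n M (dec : seq bool -> 'I_M)
    (c : 'I_M -> bool) (k : 'I_M -> nat) : 0 < p < 1 -> 0 < q < 1 ->
  (forall m, k m <= n)%N ->
  \sum_(m < M) concat_mean (ref_laws p q (c m) (k m)) (fun z => (dec z == m)%:R) <=
  2 * n.+1%:R.
Proof.
move=> p01 q01 kn.
have b01 (b : bool) : 0 <= (b%:R : R) <= 1 by case: b; rewrite ?lexx ler01.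
pose S (z : 'I_n.+1 * bool) (m : 'I_M) :=
  concat_mean (ref_laws p q z.2 z.1) (fun y => (dec y == m)%:R).
have S0 z m : 0 <= S z m.
  by have /andP[] := concat_mean_between (all_pmf_ref z.2 z.1 p01 q01) (fun y => b01 (dec y == m)).
apply: (@le_trans _ _ (\sum_(m < M) \sum_z S z m)).
  apply: ler_sum => m _; rewrite (bigD1 (inord (k m), c m))//= {1}/S/= inordK ?ltnS//.
  by rewrite lerDl; apply: sumr_ge0 => z _.
rewrite exchange_big/=.
rewrite (eq_bigr (fun=> 1)); last first.
  move=> z _; rewrite /S -concat_mean_sum; last 2 first.
  - exact: all_pmf_ref.
  - by move=> m y; have /andP[h1 h2] := b01 (dec y == m); rewrite ger0_norm.
  have -> : (fun y => \sum_(m < M) (dec y == m)%:R) = (fun=> 1 : R).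
    apply/funext => y; rewrite (bigD1 (dec y))//= eqxx big1 ?addr0// => m.
    by rewrite eq_sym => /negPf ->.
  by rewrite concat_mean_cst//; exact: all_pmf_ref.
by rewrite sumr_const card_prod card_ord card_bool mulnC natrM.
Qed.

(* kbar is the mean number of runs of a codeword.  The role of Fano's inequality is played by
   the bound 2(n+1) on the total reference mass of the decoding sets, one unit for each first
   bit and each number of runs. *)
Lemma code_converse (R : realType) (p : R) n M (enc : 'I_M -> n.-tuple bool)
    (dec : seq bool -> 'I_M) : 0 < p < 1 -> (0 < n)%N ->
  exists e kbar : R, [/\ avg_error (geometric_pmf p) enc dec = e%:E,
    0 < kbar, kbar <= n%:R &
    forall q, 0 < q < 1 ->
      (1 - e) * ln M%:R <= kbar * - ln (y0 p q) - n%:R / (1 - p) * ln q +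
        ln (2 * n.+1%:R) + 1].
Proof.
move=> p01 n0.
have M0 : (0 < M)%N by case: (dec [::]) => i; exact: leq_ltn_trans.
have M0R : 0 < M%:R :> R by rewrite ltr0n.
have M1R : 1 <= M%:R :> R by rewrite ler1n.
have /choice[cb cbP] : forall m : 'I_M, exists cb : bool * seq nat,
    (sumn cb.2 + size cb.2)%N = n /\
    forall f : seq bool -> R, (forall z, 0 <= f z <= 1) ->
      concat_mean (bits_laws p (enc m)) f = concat_mean (runs_laws p cb.1 cb.2) f.
  move=> m; have [c [bs [h1 h2]]] := run_decomposition (enc m) p01.
  by exists (c, bs); rewrite h1 size_tuple.
pose E m := [set y | dec y <> m].
have EE m z : \1_(E m) z = 1 - (dec z == m)%:R :> R.
  rewrite indicE; case: eqP => [zm|zm].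
    by rewrite memNset ?subrr// => /(_ zm).
  by rewrite mem_set ?subr0.
have b01 (b : bool) : 0 <= (b%:R : R) <= 1 by case: b; rewrite ?lexx ler01.
have E01 m z : 0 <= (\1_(E m) z : R) <= 1 by rewrite indicE.
have En m z : `|\1_(E m) z : R| <= 1 by have /andP[h1 h2] := E01 m z; rewrite ger0_norm.
pose err m := concat_mean (runs_laws p (cb m).1 (cb m).2) (\1_(E m) : _ -> R).
pose k m := size (cb m).2.
have kn m : (k m <= n)%N by rewrite -(cbP m).1 leq_addl.
have k0 m : (0 < k m)%N.
  by rewrite /k; have [h _] := cbP m; case: (cb m).2 h => // h; move: n0; rewrite -h.
exists (M%:R^-1 * \sum_(m < M) err m), (M%:R^-1 * \sum_(m < M) (k m)%:R); split.
- rewrite /avg_error EFinM -sumEFin; congr (_ * _)%E; apply: eq_bigr => m _.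
  rewrite (repeat_channelE (enc m) (E m) p01); congr EFin.
  by apply: (cbP m).2; exact: E01.
- rewrite mulr_gt0 ?invr_gt0//; apply: (@lt_le_trans _ _ (\sum_(m < M) 1)).
    by rewrite sumr_const card_ord.
  by apply: ler_sum => m _; rewrite ler1n.
- rewrite ler_pdivrMl// mulr_natl -[X in _ *+ X]card_ord -sumr_const.
  by apply: ler_sum => m _; rewrite ler_nat.
move=> q q01.
pose s m := concat_mean (ref_laws p q (cb m).1 (k m)) (fun z => (dec z == m)%:R).
set K := 2 * n.+1%:R; have K1 : 1 <= K.
  by rewrite /K; have : 1 <= n.+1%:R :> R by [rewrite ler1n]; lra.
have K0 : 0 < K by lra.
have sK : \sum_(m < M) s m <= K by exact: ref_decoding_mass.
have s0 m : 0 <= s m.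
  by have /andP[] := concat_mean_between (all_pmf_ref (cb m).1 (k m) p01 q01) (fun y => b01 (dec y == m)).
have Hm m : ln M%:R * (1 - err m) <=
    (k m)%:R * - ln (y0 p q) - n%:R / (1 - p) * ln q + (ln K + M%:R * (s m / K)).
  (* Equal to M where m is decoded and 1 elsewhere: the channel mean of ln f is (1 - err m) ln M,
     and the reference mean of f is 1 + (M - 1) s m. *)
  pose f z : R := 1 + (M%:R - 1) * (dec z == m)%:R.
  have fM z : 1 <= f z <= M%:R by rewrite /f; case: (dec z == m); rewrite ?mulr1 ?mulr0; lra.
  have := @runs_divergence_bound _ p q M%:R (cb m).1 (cb m).2 f p01 q01 fM.
  rewrite (cbP m).1 -/(k m).
  have -> : (fun z => ln (f z)) = (fun z => ln M%:R + - ln M%:R * \1_(E m) z).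
    apply/funext => z; rewrite EE /f; case: (dec z == m).
      by rewrite mulr1 subrr mulr0 addr0 addrC subrK.
    by rewrite mulr0 addr0 ln1 subr0 mulr1 subrr.
  rewrite (@concat_mean_affine _ _ _ 1)//; last exact: all_pmf_runs.
  rewrite (@concat_mean_affine _ _ _ 1); last 2 first.
  - exact: all_pmf_ref.
  - by move=> z; have /andP[h1 h2] := b01 (dec z == m); rewrite ger0_norm.
  rewrite -/(s m) -/(err m) => h.
  have r0 : 0 < 1 + (M%:R - 1) * s m.
    by rewrite ltr_pwDl// mulr_ge0// subr_ge0.
  (* With the tangent at K the mass enters linearly, and the average over m of M (s m / K) is at
     most 1, the final constant in the bound. *)
  have := ln_le_affine r0 K0.
  have : (1 + (M%:R - 1) * s m) / K - 1 <= M%:R * (s m / K).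
    have i1 : K^-1 <= 1 by rewrite invf_le1.
    have : 0 <= s m / K by rewrite divr_ge0// ltW.
    rewrite mulrDl mul1r -mulrA mulrBl mul1r; lra.
  have -> : ln M%:R * (1 - err m) = ln M%:R + - ln M%:R * err m by ring.
  lra.
have Hs : \sum_(m < M) ln M%:R * (1 - err m) <= \sum_(m < M) ((k m)%:R * - ln (y0 p q) -
    n%:R / (1 - p) * ln q + (ln K + M%:R * (s m / K))) by apply: ler_sum => m _; exact: Hm.
move: Hs; rewrite -mulr_sumr sumrB sumr_const card_ord !big_split/= -mulr_suml -mulr_sumr -mulr_suml.
rewrite !sumr_const card_ord -[ln K *+ M]mulr_natl -[(- _) *+ M]mulr_natl => Hs.
rewrite -(ler_pM2l M0R).
have -> : M%:R * ((1 - M%:R^-1 * \sum_(m < M) err m) * ln M%:R) =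
    ln M%:R * (M%:R - \sum_(m < M) err m) by field; rewrite gt_eqF.
apply: (le_trans Hs).
have -> : M%:R * (M%:R^-1 * (\sum_(m < M) (k m)%:R) * - ln (y0 p q) - n%:R / (1 - p) * ln q + ln K + 1) =
    (\sum_(m < M) (k m)%:R) * - ln (y0 p q) + M%:R * - (n%:R / (1 - p) * ln q) + (M%:R * ln K + M%:R * 1).
  field; rewrite !gt_eqF// subr_gt0; by have /andP[] := p01.
rewrite !lerD2l ler_wpM2l ?(ltW M0R)// ler_pdivrMr// mul1r.
exact: sK.
Qed.

Lemma ln_natS_le (R : realType) (d : R) : 0 < d ->
  exists N, forall n, (N <= n)%N -> ln (2 * n.+1%:R) + 1 <= d * n%:R.
Proof.
(* The tangent at 4 / d has slope d / 4, which turns 2 (n + 1) into d (n + 1) / 2; the other half of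
   d n absorbs the constants. *)
move=> d0; set c := 4 / d; have c0 : 0 < c by rewrite divr_gt0.
exists (Num.truncn (1 + 2 * `|ln c| / d)).+1 => n Nn.
have h0 : 0 < 2 * n.+1%:R :> R by rewrite mulr_gt0// ltr0n.
have h1 := ln_le_affine h0 c0.
have h2 : 1 + 2 * `|ln c| / d <= n%:R.
  apply: (@le_trans _ _ (Num.truncn (1 + 2 * `|ln c| / d)).+1%:R); last by rewrite ler_nat.
  by apply: ltW; exact: truncnS_gt.
have h3 := ler_wpM2l (ltW d0) h2.
have e3 : d * (1 + 2 * `|ln c| / d) = d + 2 * `|ln c| by field; rewrite gt_eqF.
have e1 : 2 * n.+1%:R / c = (d * n%:R + d) / 2.
  by rewrite /c -natr1; field; rewrite gt_eqF.
have := ler_norm (ln c); rewrite e3 in h3; rewrite e1 in h1; lra.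
Qed.

Lemma Cap_le_mu_bound (R : realType) (p : R) : 0 < p < 1 ->
  (Cap (geometric_pmf p) <= mu_bound p)%E.
Proof.
move=> p01; have /andP[p0 p1] := p01; have a0 : 0 < 1 - p by rewrite subr_gt0.
apply: ge_ereal_sup => _ [r /= ach <-].
apply/lee_addgt0Pr => d d0.
(* Half of d pays for the loss eps r, where r may be negative; the other half pays for the
   logarithmic terms. *)
pose eps := d / (2 * (`|r| + 1 + d)).
have den0 : 0 < 2 * (`|r| + 1 + d) by have := normr_ge0 r; lra.
have eps0 : 0 < eps by rewrite divr_gt0.
have eps1 : eps <= 1 by rewrite ler_pdivrMr// mul1r; have := normr_ge0 r; lra.
have epsr : eps * r <= d / 2.
  apply: (@le_trans _ _ (eps * (`|r| + 1 + d))).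
    by rewrite ler_wpM2l ?(ltW eps0)//; have := ler_norm r; lra.
  by rewrite /eps; rewrite le_eqVlt; apply/orP; left; apply/eqP; field; rewrite gt_eqF//; have := normr_ge0 r; lra.
have [N1 HN1] := ach eps eps0.
have d20 : 0 < d / 2 by rewrite divr_gt0.
have [N2 HN2] := ln_natS_le d20.
pose n := (maxn N1 N2).+1.
have [M [enc [dec [Mr err]]]] := HN1 n (leqW (leq_maxl _ _)).
have hK := HN2 n (leqW (leq_maxr _ _)).
have [e [kbar [eE kb0 kbn conv]]] := code_converse enc dec p01 (ltn0Sn _ : (0 < n)%N).
rewrite eE lee_fin in err.
have n0 : 0 < n%:R :> R by rewrite ltr0n.
(* A single block length suffices for each d, and this mu does not involve q, so [conv] can be used
   for every q in the infimum. *)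
pose mu := n%:R / ((1 - p) * kbar).
have mu0 : 0 < mu by rewrite divr_gt0// mulr_gt0.
have M1 : 1 <= M%:R :> R.
  by rewrite ler1n; case: (dec [::]) => i; exact: leq_ltn_trans.
have lnM0 : 0 <= ln M%:R :> R by rewrite ln_ge0.
have lnMr : n%:R * r <= ln M%:R by rewrite -ler_expR lnK// posrE; lra.
have v1 : (1 - eps) * (n%:R * r) <= (1 - e) * ln M%:R.
  apply: (@le_trans _ _ ((1 - eps) * ln M%:R)); first by rewrite ler_wpM2l// subr_ge0.
  by rewrite ler_wpM2r// lerD2l lerN2.
rewrite -leeBlDr// -EFinB.
apply: (@le_trans _ _ (dual_inf p mu / (mu * (1 - p))%:E)%E); last first.
  apply: ereal_sup_ubound; exists mu => //=.
  rewrite /mu ler_pdivlMr ?mulr_gt0// div1r mulrA mulVf ?mul1r// gt_eqF//.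
have muap : 0 < mu * (1 - p) by rewrite mulr_gt0.
rewrite inver gt_eqF// lee_pdivlMr// -EFinM.
apply: le_ereal_inf_tmp => _ [q /= q01 <-]; rewrite lee_fin.
have muE : mu * (1 - p) = n%:R / kbar by rewrite /mu; field; rewrite !gt_eqF.
rewrite muE mulrA ler_pdivrMr//.
have -> : (- ln (y0 p q) - mu * ln q) * kbar = kbar * - ln (y0 p q) - n%:R / (1 - p) * ln q.
  by rewrite /mu; field; rewrite !gt_eqF.
have := conv q q01.
have : (r - d) * n%:R <= (1 - eps) * (n%:R * r) - d / 2 * n%:R.
  have := ler_wpM2r (ltW n0) epsr; nra.
lra.
Qed.

Theorem corollary8 (R : realType) (p : R) (p01 : 0 < p < 1) :
  [/\ forall q : R, 0 < q < 1 -> (Y_norm p q < +oo)%E,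
      (Cap (geometric_pmf p) <= mu_bound p)%E &
      (mu_bound p <= q_bound p)%E].
Proof.
split.
- by move=> q q01; exact: Y_norm_lty.
- exact: Cap_le_mu_bound.
- exact: mu_bound_le_q_bound.
Qed.
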